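(* With the parameters, functions and constants of the context, consider the problem of finding two $C^2$-functions $V_0,V_1:\mathbb R_+\to\mathbb R_+$, where $\mathbb R_+:=[0,\infty)$, and a constant $x^*\ge\widetilde K$ such that (a) $V_i(0+)=0$ for $i=0,1$; (b) $-rV_0(x)+\mathcal A_0V_0(x)+\lambda_0(V_1(x)-V_0(x))=0$ for all $x>0$; (c) $-rV_1(x)+\mathcal A_1V_1(x)+\lambda_1(V_0(x)-V_1(x))=0$ for all $0<x<x^*$; (d) $-rV_1(x)+\mathcal A_1V_1(x)+\lambda_1(V_0(x)-V_1(x))+\eta(\pi(x)-V_1(x))=0$ for all $x>x^*$; (e) $V_1(x^* )=\pi(x^* )$; (f) $0<\lim_{x\to\infty}\dfrac{V_1(x)}{\pi(x)}<1$. This problem has the following unique solution $(V_0,V_1,x^* )$: for $i=0,1$, $$V_i(x)=A^L_ix^{\beta^L_A}+B^L_ix^{\beta^L_B}\ \ (0<x<x^* ),\qquad V_i(x)=A^U_ix^{\beta^U_A}+B^U_ix^{\beta^U_B}+a_ix+b_i\ \ (x>x^* ),$$ and $$x^*=-\frac{\frac{(1-\beta^L_A)Q^L_A}{G^L_0(\beta^L_A)}+\frac{(1-\beta^L_B)Q^L_B}{G^L_0(\beta^L_B)}+\frac{(\beta^U_A-1)Q^U_A}{G^U_0(\beta^U_A)}+\frac{(\beta^U_B-1)Q^U_B}{G^U_0(\beta^U_B)}+\frac{b_0}{\lambda_0}}{\frac{(1-\beta^L_A)P^L_A}{G^L_0(\beta^L_A)}+\frac{(1-\beta^L_B)P^L_B}{G^L_0(\beta^L_B)}+\frac{(\beta^U_A-1)P^U_A}{G^U_0(\beta^U_A)}+\frac{(\beta^U_B-1)P^U_B}{G^U_0(\beta^U_B)}},$$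 where, for $k\in\{L,U\}$, $$A^k_1=(x^* )^{-\beta^k_A}(P^k_Ax^*+Q^k_A),\quad B^k_1=(x^* )^{-\beta^k_B}(P^k_Bx^*+Q^k_B),\quad A^k_0=\frac{-\lambda_0}{G^k_0(\beta^k_A)}A^k_1,\quad B^k_0=\frac{-\lambda_0}{G^k_0(\beta^k_B)}B^k_1.$$
   Context: **Parameters.** $r>0$; $\mu_0,\mu_1\in\mathbb{R}$ with $r>\max(\mu_0,\mu_1)$; $\sigma_0,\sigma_1>0$; $\lambda_0,\lambda_1>0$; $\eta>0$; $\alpha>0$, $K\ge0$, $I\ge0$ with $(K,I)\ne(0,0)$. Put $\pi(x)=\alpha(x-K)^+-I$ and $\widetilde K:=K+I/\alpha$. For a $C^2$ function $f$ and $i=0,1$, $(\mathcal A_if)(x):=\mu_ixf'(x)+\frac12\sigma_i^2x^2f''(x)$, $x>0$. **Characteristic functions and exponents.** For $i=0,1$ and $k\in\{L,U\}$ let $$G^k_i(\beta):=\tfrac12\sigma_i^2\beta(\beta-1)+\mu_i\beta-(\lambda_i+r+\eta\mathbf 1_{\{i=1,k=U\}}),\qquad F^k(\beta):=G^k_0(\beta)G^k_1(\beta)-\lambda_0\lambda_1.$$ Each quartic equation $F^k(\beta)=0$ has four distinct real solutions, two positive and two negative. $\beta^L_A>\beta^L_B$ denote the two positive solutions of $F^L(\beta)=0$ (both are $>1$), and $\beta^U_B<\beta^U_A$ denote the two negative solutions of $F^U(\beta)=0$. **Constants.** $$a_0=\tfrac{\alpha\eta\lambda_0}{D},\quad a_1=\tfrac{\alpha\eta(r-\mu_0+\lambda_0)}{D},\quad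 D=(r-\mu_0+\lambda_0)(r-\mu_1+\lambda_1+\eta)-\lambda_0\lambda_1,$$ $$b_0=\tfrac{\alpha\widetilde K\eta\lambda_0}{E},\quad b_1=\tfrac{\alpha\widetilde K\eta(r+\lambda_0)}{E},\quad E=\lambda_0\lambda_1-(r+\lambda_0)(r+\lambda_1+\eta).$$ With $S:=\beta^L_A+\beta^L_B-\beta^U_A-\beta^U_B$, $D_L:=(\beta^L_A-\beta^L_B)S$, $D_U:=(\beta^U_A-\beta^U_B)S$: $$P^L_A=\tfrac{\alpha(\beta^L_B-\beta^U_A)(-\beta^L_B+\beta^U_B)+a_1(\beta^U_A-1)(\beta^U_B-1)}{D_L},\quad Q^L_A=\tfrac{-\alpha\widetilde K(\beta^L_B-\beta^U_A)(-\beta^L_B+\beta^U_B)+b_1\beta^U_A\beta^U_B}{D_L},$$ $$P^L_B=\tfrac{\alpha(\beta^L_A-\beta^U_A)(\beta^L_A-\beta^U_B)-a_1(\beta^U_A-1)(\beta^U_B-1)}{D_L},\quad Q^L_B=\tfrac{-\alpha\widetilde K(\beta^L_A-\beta^U_A)(\beta^L_A-\beta^U_B)-b_1\beta^U_A\beta^U_B}{D_L},$$ $$P^U_A=\tfrac{\alpha(\beta^L_A-\beta^U_B)(\beta^L_B-\beta^U_B)+a_1(\beta^U_B-1)(\beta^L_A+\beta^L_B-\beta^U_B-1)}{D_U},\quad Q^U_A=\tfrac{-\alpha\widetilde K(\beta^L_A-\beta^U_B)(\beta^L_B-\beta^U_B)+b_1\beta^U_B(\beta^L_A+\beta^L_B-\beta^U_B)}{D_U},$$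 $$P^U_B=\tfrac{\alpha(\beta^L_A-\beta^U_A)(-\beta^L_B+\beta^U_A)-a_1(\beta^U_A-1)(\beta^L_A+\beta^L_B-\beta^U_A-1)}{D_U},\quad Q^U_B=\tfrac{-\alpha\widetilde K(\beta^L_A-\beta^U_A)(-\beta^L_B+\beta^U_A)-b_1\beta^U_A(\beta^L_A+\beta^L_B-\beta^U_A)}{D_U}.$$ Here $V_i(0+)=\lim_{x\downarrow0}V_i(x)$.
   Formalization: The generator is taken as μ_i x f'(x) + ½σ_i²x²f''(x); with μ_i f'(x) as written the stated V_i fail the equations whenever some μ_i ≠ 0. ''C² on R_+'' means C² on (0,∞) and continuous on [0,∞), as x^β with 1<β<2 is not C² at 0. *)

(* Defs.v *)
From Stdlib Require Import Reals.
From Coquelicot Require Import Coquelicot.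
Open Scope R_scope.

Inductive regime := regime0 | regime1.

(* [Lower] is the region x < x*, [Upper] the region x > x*. *)
Inductive region := Lower | Upper.

Record params := Params {
  r : R;
  mu : regime -> R;
  sigma : regime -> R;
  lambda : regime -> R;
  eta : R;
  alpha : R;
  K : R;
  Icost : R
}.

Definition admissible (p : params) : Prop :=
  0 < r p /\
  (forall i, mu p i < r p) /\
  (forall i, 0 < sigma p i) /\
  (forall i, 0 < lambda p i) /\
  0 < eta p /\
  0 < alpha p /\
  0 <= K p /\
  0 <= Icost p /\
  (K p, Icost p) <> (0, 0).

Definition payoff (p : params) (x : R) : R :=
  alpha p * Rmax (x - K p) 0 - Icost p.

Definition Ktilde (p : params) : R := K p + Icost p / alpha p.

Definition generator (p : params) (i : regime) (f : R -> R) (x : R) : R :=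
  mu p i * x * Derive f x + / 2 * sigma p i ^ 2 * x ^ 2 * Derive_n f 2 x.

Definition G (p : params) (k : region) (i : regime) (beta : R) : R :=
  / 2 * sigma p i ^ 2 * beta * (beta - 1) + mu p i * beta
  - (lambda p i + r p
     + match i, k with regime1, Upper => eta p | _, _ => 0 end).

Definition F (p : params) (k : region) (beta : R) : R :=
  G p k regime0 beta * G p k regime1 beta - lambda p regime0 * lambda p regime1.

(* [bA k] and [bB k] stand for beta^k_A and beta^k_B.  Each F p k has exactly
   two positive and two negative roots, so these conditions determine them. *)
Definition is_exponents (p : params) (bA bB : region -> R) : Prop :=
  F p Lower (bA Lower) = 0 /\ F p Lower (bB Lower) = 0 /\
  0 < bB Lower < bA Lower /\
  F p Upper (bA Upper) = 0 /\ F p Upper (bB Upper) = 0 /\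
  bB Upper < bA Upper < 0.

Definition constD (p : params) : R :=
  (r p - mu p regime0 + lambda p regime0)
  * (r p - mu p regime1 + lambda p regime1 + eta p)
  - lambda p regime0 * lambda p regime1.

Definition constE (p : params) : R :=
  lambda p regime0 * lambda p regime1
  - (r p + lambda p regime0) * (r p + lambda p regime1 + eta p).

Definition a (p : params) (i : regime) : R :=
  match i with
  | regime0 => alpha p * eta p * lambda p regime0 / constD p
  | regime1 =>
      alpha p * eta p * (r p - mu p regime0 + lambda p regime0) / constD p
  end.

Definition b (p : params) (i : regime) : R :=
  match i with
  | regime0 => alpha p * Ktilde p * eta p * lambda p regime0 / constE p
  | regime1 =>
      alpha p * Ktilde p * eta p * (r p + lambda p regime0) / constE p
  end.

Definition constS (bA bB : region -> R) : R :=
  bA Lower + bB Lower - bA Upper - bB Upper.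

Definition denom (bA bB : region -> R) (k : region) : R :=
  (bA k - bB k) * constS bA bB.

Definition PA (p : params) (bA bB : region -> R) (k : region) : R :=
  match k with
  | Lower =>
      (alpha p * (bB Lower - bA Upper) * (- bB Lower + bB Upper)
       + a p regime1 * (bA Upper - 1) * (bB Upper - 1))
      / denom bA bB Lower
  | Upper =>
      (alpha p * (bA Lower - bB Upper) * (bB Lower - bB Upper)
       + a p regime1 * (bB Upper - 1) * (bA Lower + bB Lower - bB Upper - 1))
      / denom bA bB Upper
  end.

Definition QA (p : params) (bA bB : region -> R) (k : region) : R :=
  match k with
  | Lower =>
      (- alpha p * Ktilde p * (bB Lower - bA Upper) * (- bB Lower + bB Upper)
       + b p regime1 * bA Upper * bB Upper)
      / denom bA bB Lower
  | Upper =>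
      (- alpha p * Ktilde p * (bA Lower - bB Upper) * (bB Lower - bB Upper)
       + b p regime1 * bB Upper * (bA Lower + bB Lower - bB Upper))
      / denom bA bB Upper
  end.

Definition PB (p : params) (bA bB : region -> R) (k : region) : R :=
  match k with
  | Lower =>
      (alpha p * (bA Lower - bA Upper) * (bA Lower - bB Upper)
       - a p regime1 * (bA Upper - 1) * (bB Upper - 1))
      / denom bA bB Lower
  | Upper =>
      (alpha p * (bA Lower - bA Upper) * (- bB Lower + bA Upper)
       - a p regime1 * (bA Upper - 1) * (bA Lower + bB Lower - bA Upper - 1))
      / denom bA bB Upper
  end.

Definition QB (p : params) (bA bB : region -> R) (k : region) : R :=
  match k with
  | Lower =>
      (- alpha p * Ktilde p * (bA Lower - bA Upper) * (bA Lower - bB Upper)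
       - b p regime1 * bA Upper * bB Upper)
      / denom bA bB Lower
  | Upper =>
      (- alpha p * Ktilde p * (bA Lower - bA Upper) * (- bB Lower + bA Upper)
       - b p regime1 * bA Upper * (bA Lower + bB Lower - bA Upper))
      / denom bA bB Upper
  end.

Definition xstar (p : params) (bA bB : region -> R) : R :=
  - (((1 - bA Lower) * QA p bA bB Lower / G p Lower regime0 (bA Lower)
      + (1 - bB Lower) * QB p bA bB Lower / G p Lower regime0 (bB Lower)
      + (bA Upper - 1) * QA p bA bB Upper / G p Upper regime0 (bA Upper)
      + (bB Upper - 1) * QB p bA bB Upper / G p Upper regime0 (bB Upper)
      + b p regime0 / lambda p regime0)
     /
     ((1 - bA Lower) * PA p bA bB Lower / G p Lower regime0 (bA Lower)
      + (1 - bB Lower) * PB p bA bB Lower / G p Lower regime0 (bB Lower)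
      + (bA Upper - 1) * PA p bA bB Upper / G p Upper regime0 (bA Upper)
      + (bB Upper - 1) * PB p bA bB Upper / G p Upper regime0 (bB Upper))).

Definition coefA (p : params) (bA bB : region -> R) (k : region) (i : regime)
    (xs : R) : R :=
  let A1 := Rpower xs (- bA k) * (PA p bA bB k * xs + QA p bA bB k) in
  match i with
  | regime0 => - lambda p regime0 / G p k regime0 (bA k) * A1
  | regime1 => A1
  end.

Definition coefB (p : params) (bA bB : region -> R) (k : region) (i : regime)
    (xs : R) : R :=
  let B1 := Rpower xs (- bB k) * (PB p bA bB k * xs + QB p bA bB k) in
  match i with
  | regime0 => - lambda p regime0 / G p k regime0 (bB k) * B1
  | regime1 => B1
  end.

(* Functions [0,oo) -> [0,oo) are represented by total functions on R of which
   only the values on [0,oo) matter.  C^2 is required on (0,oo), with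
   continuity up to 0: x^beta with 1 < beta < 2 has no second derivative at 0,
   and beta^L_B may lie in that range.  [Derive] is total, hence the explicit
   differentiability conditions. *)
Definition C2_nonneg (f : R -> R) : Prop :=
  (forall x, 0 <= x -> 0 <= f x) /\
  continuous_on (fun x => 0 <= x) f /\
  (forall x, 0 < x ->
     ex_derive f x /\ ex_derive (Derive f) x /\ continuous (Derive_n f 2) x).

Definition is_solution (p : params) (V : regime -> R -> R) (xs : R) : Prop :=
  (forall i, C2_nonneg (V i)) /\
  Ktilde p <= xs /\
  (forall i, filterlim (V i) (at_right 0) (locally 0)) /\
  (forall x, 0 < x ->
     - r p * V regime0 x + generator p regime0 (V regime0) x
     + lambda p regime0 * (V regime1 x - V regime0 x) = 0) /\
  (forall x, 0 < x < xs ->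
     - r p * V regime1 x + generator p regime1 (V regime1) x
     + lambda p regime1 * (V regime0 x - V regime1 x) = 0) /\
  (forall x, xs < x ->
     - r p * V regime1 x + generator p regime1 (V regime1) x
     + lambda p regime1 * (V regime0 x - V regime1 x)
     + eta p * (payoff p x - V regime1 x) = 0) /\
  V regime1 xs = payoff p xs /\
  (exists l : R,
     is_lim (fun x => V regime1 x / payoff p x) p_infty l /\ 0 < l < 1).

(* Main.v *)
Require Import Defs.
From Stdlib Require Import Reals Lra Classical.
From Coquelicot Require Import Coquelicot.
Open Scope R_scope.

(* Fix a threshold [y].  The regime 1 equations and the requirement that [V_1] be
   C^2 with value [payoff y] at [y] determine explicit combinations of powers (the
   constants P and Q), for which [V_0] is continuous; the only remaining condition
   is that [V_0'] have no jump at [y].  This jump is affine in [y], and its zero is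
   [xstar].  A minimum principle for supersolutions that may have concave kinks at
   [y] gives the rest.  Compared with the supersolution [alpha x], it shows that the
   slope of the jump has a strict sign; applied at [y = Ktilde], that the zero lies
   to the right of [Ktilde]; applied to the candidate, that it is nonnegative.  For
   uniqueness, subtract from a solution with threshold [ys] the candidate with the
   same threshold: up to sign the difference has a concave kink, so it is
   nonnegative, but its regime 1 component vanishes at [ys], which rules out the
   kink and forces [ys = xstar]; then both signs apply. *)

(** * One-sided necessary conditions at a minimum *)

Lemma right_min_derive (f : R -> R) (x d l : R) :
  0 < d -> is_derive f x l -> (forall z, x < z < x + d -> f x <= f z) -> 0 <= l.
Proof.
intros Hd Hf Hmin.
apply Rnot_lt_le; intros Hl.
apply is_derive_Reals in Hf.
destruct (Hf (- l) ltac:(lra)) as [delta Hdelta].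
assert (Hdp := cond_pos delta).
set (h := Rmin delta d / 2).
assert (Hh : 0 < h /\ h < delta /\ h < d).
{ unfold h; generalize (Rmin_l delta d) (Rmin_r delta d) (Rmin_glb_lt delta d 0 Hdp Hd); lra. }
specialize (Hdelta h ltac:(lra) ltac:(rewrite Rabs_pos_eq; lra)).
apply Rabs_def2 in Hdelta.
assert (0 <= (f (x + h) - f x) / h).
{ apply Rdiv_le_0_compat; [|lra]. generalize (Hmin (x + h) ltac:(lra)); lra. }
lra.
Qed.

Lemma left_min_derive (f : R -> R) (x d l : R) :
  0 < d -> is_derive f x l -> (forall z, x - d < z < x -> f x <= f z) -> l <= 0.
Proof.
intros Hd Hf Hmin.
cut (0 <= - l); [lra|].
apply (right_min_derive (fun z => f (- z)) (- x) d (- l) Hd).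
- replace (- l) with (scal (-1) l) by (unfold scal; simpl; unfold mult; simpl; ring).
  apply (is_derive_comp f Ropp); [rewrite Ropp_involutive; exact Hf|].
  auto_derive; trivial; ring.
- intros z Hz; rewrite Ropp_involutive; apply Hmin; lra.
Qed.

(** If [l] were negative, [f1] would be negative just to the right of [x], and by the mean value
    theorem [f] would drop below [f x]. The condition is one-sided because at a kink each smooth
    piece is known to be minimal on one side only. *)
Lemma right_min_second_derive (f f1 : R -> R) (x d l : R) :
  0 < d -> (forall z, x <= z < x + d -> is_derive f z (f1 z)) ->
  is_derive f1 x l -> f1 x = 0 ->
  (forall z, x < z < x + d -> f x <= f z) -> 0 <= l.
Proof.
intros Hd Hf Hf1 H0 Hmin.
apply Rnot_lt_le; intros Hl.
apply is_derive_Reals in Hf1.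
destruct (Hf1 (- l) ltac:(lra)) as [delta Hdelta].
assert (Hdp := cond_pos delta).
set (h := Rmin delta d / 2).
assert (Hh : 0 < h /\ h < delta /\ h < d).
{ unfold h; generalize (Rmin_l delta d) (Rmin_r delta d) (Rmin_glb_lt delta d 0 Hdp Hd); lra. }
destruct (MVT_cor2 f f1 x (x + h)) as [c [Hc1 Hc2]]; [lra| |].
{ intros c Hc; apply is_derive_Reals, Hf; lra. }
specialize (Hdelta (c - x) ltac:(lra) ltac:(rewrite Rabs_pos_eq; lra)).
replace (x + (c - x)) with c in Hdelta by ring.
apply Rabs_def2 in Hdelta.
assert (Hneg : f1 c < 0).
{ replace (f1 c) with ((f1 c - f1 x) / (c - x) * (c - x)) by (rewrite H0; field; lra).
  apply Ropp_lt_cancel; rewrite Ropp_0, <- Ropp_mult_distr_l_reverse.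
  apply Rmult_lt_0_compat; lra. }
generalize (Hmin (x + h) ltac:(lra)); nra.
Qed.

(** * Functions carried with their derivatives, and gluing at a threshold *)

(** Indices 0, 1, 2 hold a function and its first two derivatives. With explicit derivatives the
    differential operator below is an algebraic expression, linear by [ring]. *)
Definition jet := nat -> R -> R.

Definition is_jet (f : jet) : Prop :=
  forall x, 0 < x ->
    is_derive (f 0%nat) x (f 1%nat x) /\
    is_derive (f 1%nat) x (f 2%nat x) /\ continuous (f 2%nat) x.

Lemma is_jet_lin (s t : R) (f g : jet) :
  is_jet f -> is_jet g -> is_jet (fun n x => s * f n x + t * g n x).
Proof.
intros Hf Hg x Hx.
destruct (Hf x Hx) as [A [B C]], (Hg x Hx) as [A' [B' C']].
split; [|split].
- apply (is_derive_plus (fun x => s * f 0%nat x) (fun x => t * g 0%nat x));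
    apply is_derive_scal; assumption.
- apply (is_derive_plus (fun x => s * f 1%nat x) (fun x => t * g 1%nat x));
    apply is_derive_scal; assumption.
- apply (continuous_plus (fun x => s * f 2%nat x) (fun x => t * g 2%nat x)).
  + apply (continuous_scal_r s (f 2%nat)); assumption.
  + apply (continuous_scal_r t (g 2%nat)); assumption.
Qed.

Definition pow_jet (beta : R) : jet := fun n x =>
  match n with
  | 0%nat => Rpower x beta
  | 1%nat => beta * Rpower x beta / x
  | _ => beta * (beta - 1) * Rpower x beta / x ^ 2
  end.

Lemma is_derive_Rpower (beta x : R) :
  0 < x -> is_derive (fun z => Rpower z beta) x (beta * Rpower x beta / x).
Proof. intros Hx; unfold Rpower; auto_derive; [trivial|field; lra]. Qed.

Lemma is_jet_pow (beta : R) : is_jet (pow_jet beta).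
Proof.
intros x Hx; unfold pow_jet, Rpower; split; [|split].
- apply is_derive_Rpower, Hx.
- auto_derive; [repeat split; trivial; lra|field; lra].
- apply (ex_derive_continuous (V := R_NormedModule)).
  auto_derive; repeat split; trivial; nra.
Qed.

Lemma jet_continuity (f : jet) (x : R) :
  is_jet f -> 0 < x -> continuity_pt (f 0%nat) x.
Proof.
intros Hf Hx; apply continuity_pt_filterlim.
apply (ex_derive_continuous (V := R_NormedModule)).
exists (f 1%nat x); apply Hf, Hx.
Qed.

(** The premise [f 1 x <= 0] of the second clause is supplied from the left: by minimality there, or
    at a kink by its concavity. *)
Lemma jet_right_min (f : jet) (x d : R) :
  is_jet f -> 0 < x -> 0 < d -> (forall z, x < z < x + d -> f 0%nat x <= f 0%nat z) ->
  0 <= f 1%nat x /\ (f 1%nat x <= 0 -> f 1%nat x = 0 /\ 0 <= f 2%nat x).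
Proof.
intros Hf Hx Hd Hmin.
assert (H1 : 0 <= f 1%nat x)
  by (apply (right_min_derive (f 0%nat) x d); trivial; apply Hf, Hx).
split; trivial; intros H2.
assert (H3 : f 1%nat x = 0) by lra.
split; trivial.
apply (right_min_second_derive (f 0%nat) (f 1%nat) x d); trivial.
- intros z Hz; apply Hf; lra.
- apply Hf, Hx.
Qed.

Lemma jet_left_min (f : jet) (x d : R) :
  is_jet f -> 0 < x -> 0 < d -> (forall z, x - d < z < x -> f 0%nat x <= f 0%nat z) ->
  f 1%nat x <= 0.
Proof.
intros Hf Hx Hd Hmin; apply (left_min_derive (f 0%nat) x d); trivial; apply Hf, Hx.
Qed.

Definition glue (y : R) (f g : R -> R) (x : R) : R :=
  if Rle_dec x y then f x else g x.

Lemma glue_l y f g x : x <= y -> glue y f g x = f x.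
Proof. intros H; unfold glue; destruct (Rle_dec x y); [trivial|lra]. Qed.

Lemma glue_r y f g x : f y = g y -> y <= x -> glue y f g x = g x.
Proof.
intros E H; unfold glue; destruct (Rle_dec x y); trivial.
replace x with y by lra; trivial.
Qed.

Lemma glue_continuous (y : R) (f g : R -> R) (x : R) :
  f y = g y -> continuous f x -> continuous g x -> continuous (glue y f g) x.
Proof.
intros E Hf Hg P HP.
change (locally x (fun z => P (glue y f g z))).
destruct (Rtotal_order x y) as [H|[H|H]].
- rewrite glue_l in HP by lra.
  generalize (filter_and (F := locally x) _ _ (Hf P HP) (open_lt y x H)); apply filter_imp.
  intros z [Hz1 Hz2]; rewrite glue_l by lra; trivial.
- rewrite glue_l in HP by lra.
  assert (HP' : locally (g x) P) by (replace (g x) with (f x) by (subst; trivial); trivial).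
  generalize (filter_and (F := locally x) _ _ (Hf P HP) (Hg P HP')); apply filter_imp.
  intros z [Hz1 Hz2]; unfold glue; destruct (Rle_dec z y); trivial.
- rewrite glue_r in HP by (trivial; lra).
  generalize (filter_and (F := locally x) _ _ (Hg P HP) (open_gt y x H)); apply filter_imp.
  intros z [Hz1 Hz2]; rewrite glue_r by (trivial; lra); trivial.
Qed.

Lemma glue_is_derive (y : R) (f g : R -> R) (x : R) (f1 g1 : R -> R) :
  f y = g y -> f1 y = g1 y ->
  is_derive f x (f1 x) -> is_derive g x (g1 x) ->
  is_derive (glue y f g) x (glue y f1 g1 x).
Proof.
intros E E1 Hf Hg.
destruct (Rtotal_order x y) as [H|[H|H]].
- rewrite glue_l by lra.
  apply is_derive_ext_loc with (2 := Hf).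
  generalize (open_lt y x H); apply filter_imp.
  intros z Hz; rewrite glue_l by lra; trivial.
- subst x; rewrite glue_l by lra.
  rewrite <- E1 in Hg.
  apply is_derive_Reals; apply is_derive_Reals in Hf; apply is_derive_Reals in Hg.
  intros eps Heps.
  destruct (Hf eps Heps) as [d1 H1], (Hg eps Heps) as [d2 H2].
  assert (Hd : 0 < Rmin d1 d2) by (apply Rmin_glb_lt; apply cond_pos).
  exists (mkposreal _ Hd); simpl; intros h Hh Hlt.
  rewrite (glue_l y f g y) by lra.
  destruct (Rle_dec (y + h) y).
  + rewrite glue_l by lra; apply H1; trivial; generalize (Rmin_l d1 d2); lra.
  + rewrite glue_r, E by (trivial; lra); apply H2; trivial; generalize (Rmin_r d1 d2); lra.
- rewrite glue_r by (trivial; lra).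
  apply is_derive_ext_loc with (2 := Hg).
  generalize (open_gt y x H); apply filter_imp.
  intros z Hz; rewrite glue_r by (trivial; lra); trivial.
Qed.

Lemma is_jet_glue (y : R) (f g : jet) :
  f 0%nat y = g 0%nat y -> f 1%nat y = g 1%nat y -> f 2%nat y = g 2%nat y ->
  is_jet f -> is_jet g -> is_jet (fun n => glue y (f n) (g n)).
Proof.
intros E0 E1 E2 Hf Hg x Hx.
destruct (Hf x Hx) as [A [B C]], (Hg x Hx) as [A' [B' C']].
split; [|split].
- apply glue_is_derive; trivial.
- apply glue_is_derive; trivial.
- apply glue_continuous; trivial.
Qed.

(** * The coupled operator and local minima of kinked supersolutions *)

Definition other (i : regime) : regime :=
  match i with regime0 => regime1 | regime1 => regime0 end.

Definition kill (p : params) (k : region) (i : regime) : R :=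
  match i, k with regime1, Upper => eta p | _, _ => 0 end.

(** This is the homogeneous part of the equations, with the source [eta * payoff] moved to the
    right-hand side; solutions satisfy [L = - kill * payoff]. *)
Definition L (p : params) (k : region) (i : regime) (f : regime -> jet) (x : R) : R :=
  mu p i * x * f i 1%nat x + / 2 * Defs.sigma p i ^ 2 * x ^ 2 * f i 2%nat x
  - (r p + kill p k i) * f i 0%nat x
  + lambda p i * (f (other i) 0%nat x - f i 0%nat x).

Lemma L_lin p k i s t (f g : regime -> jet) x :
  L p k i (fun j n z => s * f j n z + t * g j n z) x
  = s * L p k i f x + t * L p k i g x.
Proof. unfold L; ring. Qed.

Lemma kill_ge0 p k i : admissible p -> 0 <= kill p k i.
Proof. intros (_ & _ & _ & _ & H & _); destruct i, k; simpl; lra. Qed.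

(** The diffusion and coupling terms are nonnegative, and discounting a negative value at a rate at
    least [r p > 0] contributes a strictly positive term. *)
Lemma L_negative_min p k i (f : regime -> jet) x :
  admissible p -> f i 0%nat x < 0 -> f i 0%nat x <= f (other i) 0%nat x ->
  f i 1%nat x = 0 -> 0 <= f i 2%nat x -> 0 < L p k i f x.
Proof.
intros Hp H0 Hle H1 H2; unfold L; rewrite H1.
assert (Hk := kill_ge0 p k i Hp).
destruct Hp as (Hr & _ & Hs & Hl & _).
specialize (Hs i); specialize (Hl i).
assert (0 <= / 2 * Defs.sigma p i ^ 2 * x ^ 2 * f i 2%nat x).
{ apply Rmult_le_pos; trivial.
  generalize (pow2_ge_0 (Defs.sigma p i)) (pow2_ge_0 x); nra. }
assert (0 <= lambda p i * (f (other i) 0%nat x - f i 0%nat x)) by (apply Rmult_le_pos; lra).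
assert (0 < (r p + kill p k i) * - f i 0%nat x) by (apply Rmult_lt_0_compat; lra).
lra.
Qed.

(* The pair [f Lower, f Upper] stands for the function equal to the former up to
   [y] and to the latter beyond; both are smooth on the whole half-line. *)
Definition kinked_supersolution (p : params) (y : R) (f : region -> regime -> jet) : Prop :=
  (forall k i, is_jet (f k i)) /\
  (forall i x, 0 < x <= y -> L p Lower i (f Lower) x <= 0) /\
  (forall i x, y <= x -> L p Upper i (f Upper) x <= 0) /\
  (forall i, f Lower i 0%nat y = f Upper i 0%nat y) /\
  (forall i, f Upper i 1%nat y <= f Lower i 1%nat y).

Lemma kinked_supersolution_add p y s (f : region -> regime -> jet) (g : jet) :
  0 <= s -> 0 < y -> is_jet g ->
  (forall k i x, 0 < x -> L p k i (fun _ => g) x <= 0) ->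
  kinked_supersolution p y f ->
  kinked_supersolution p y (fun k i n x => 1 * f k i n x + s * g n x).
Proof.
intros Hs Hy Hg HLg (J & L1 & L2 & E & D).
split; [|split; [|split; [|split]]].
- intros k i; apply (is_jet_lin 1 s (f k i) g); trivial.
- intros i x Hx; rewrite (L_lin p Lower i 1 s (f Lower) (fun _ => g)).
  specialize (L1 i x Hx); specialize (HLg Lower i x ltac:(lra)); nra.
- intros i x Hx; rewrite (L_lin p Upper i 1 s (f Upper) (fun _ => g)).
  specialize (L2 i x Hx); specialize (HLg Upper i x ltac:(lra)); nra.
- intros i; rewrite E; trivial.
- intros i; specialize (D i); lra.
Qed.

(** The minimum is taken over both regimes, so that the coupling term has the right sign. Away from
    [y] this is the usual argument; the point [y] itself is treated with the upper piece. *)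
Lemma kinked_no_negative_min p y (f : region -> regime -> jet) i x d :
  admissible p -> 0 < y -> kinked_supersolution p y f -> 0 < d -> 0 < x ->
  let g j := glue y (f Lower j 0%nat) (f Upper j 0%nat) in
  (forall j z, x - d < z < x + d -> 0 < z -> g i x <= g j z) -> 0 <= g i x.
Proof.
intros Hp Hy (J & L1 & L2 & E & D) Hd Hx g Hmin.
apply Rnot_lt_le; intros Hneg.
assert (gL : forall j z, z <= y -> g j z = f Lower j 0%nat z)
  by (intros j z Hz; apply glue_l; trivial).
assert (gU : forall j z, y <= z -> g j z = f Upper j 0%nat z)
  by (intros j z Hz; apply glue_r; trivial).
destruct (Rlt_le_dec x y) as [Hxy|Hxy].
- set (e := Rmin d (Rmin x (y - x))).
  assert (He : 0 < e /\ e <= d /\ e <= x /\ e <= y - x).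
  { unfold e; generalize (Rmin_l d (Rmin x (y - x))) (Rmin_r d (Rmin x (y - x)))
      (Rmin_l x (y - x)) (Rmin_r x (y - x)); intros.
    repeat split; try lra. repeat apply Rmin_glb_lt; lra. }
  assert (Hm : forall z, x - e < z < x + e -> f Lower i 0%nat x <= f Lower i 0%nat z).
  { intros z Hz; rewrite <- !gL by lra; apply Hmin; lra. }
  destruct (jet_right_min (f Lower i) x e) as [H1 H2]; try lra; trivial.
  { intros; apply Hm; lra. }
  assert (H3 : f Lower i 1%nat x <= 0)
    by (apply (jet_left_min (f Lower i) x e); try lra; trivial; intros; apply Hm; lra).
  destruct (H2 H3) as [H4 H5].
  apply (Rlt_not_le (L p Lower i (f Lower) x) 0); [|apply L1; lra].
  apply L_negative_min; trivial; rewrite <- !gL by lra; trivial; apply Hmin; lra.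
- set (e := Rmin d x).
  assert (He : 0 < e /\ e <= d /\ e <= x).
  { unfold e; generalize (Rmin_l d x) (Rmin_r d x); intros.
    repeat split; try lra. apply Rmin_glb_lt; lra. }
  destruct (jet_right_min (f Upper i) x e) as [H1 H2]; try lra; trivial.
  { intros z Hz; rewrite <- !gU by lra; apply Hmin; lra. }
  assert (H3 : f Upper i 1%nat x <= 0).
  { destruct (Req_dec x y) as [->|Hne].
    (* At the kink, minimality from the left bounds the derivative of the lower piece by 0, and
       concavity passes this bound to the upper piece. *)
    - apply Rle_trans with (1 := D i).
      apply (jet_left_min (f Lower i) y e); try lra; trivial.
      intros z Hz; rewrite <- !gL by lra; apply Hmin; lra.
    - set (e' := Rmin e (x - y)).
      assert (He' : 0 < e' /\ e' <= e /\ e' <= x - y).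
      { unfold e'; generalize (Rmin_l e (x - y)) (Rmin_r e (x - y)); intros.
        repeat split; try lra. apply Rmin_glb_lt; lra. }
      apply (jet_left_min (f Upper i) x e'); try lra; trivial.
      intros z Hz; rewrite <- !gU by lra; apply Hmin; lra. }
  destruct (H2 H3) as [H4 H5].
  apply (Rlt_not_le (L p Upper i (f Upper) x) 0); [|apply L2; lra].
  apply L_negative_min; trivial; rewrite <- !gU by lra; trivial; apply Hmin; lra.
Qed.

(** * The minimum principle on the half-line *)

Lemma regime_min (g : regime -> R -> R) (l u : R) :
  l <= u -> (forall i x, l <= x <= u -> continuity_pt (g i) x) ->
  exists i z, l <= z <= u /\ forall j x, l <= x <= u -> g i z <= g j x.
Proof.
intros Hlu Hc.
destruct (continuity_ab_min (g regime0) l u Hlu (Hc regime0)) as [z0 [H0 B0]].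
destruct (continuity_ab_min (g regime1) l u Hlu (Hc regime1)) as [z1 [H1 B1]].
destruct (Rle_dec (g regime0 z0) (g regime1 z1)).
- exists regime0, z0; split; trivial; intros [] x Hx;
    [apply H0; trivial|apply Rle_trans with (1 := r); apply H1; trivial].
- exists regime1, z1; split; trivial; intros [] x Hx;
    [apply Rle_trans with (g regime0 z0); [lra|apply H0; trivial]|apply H1; trivial].
Qed.

(* [x ^ q] satisfies [L <= 0] and grows faster than linearly: it absorbs the
   behaviour at infinity in the minimum principle. *)
Definition barrier_exponent (p : params) (q : R) : Prop :=
  1 < q /\ forall i, / 2 * Defs.sigma p i ^ 2 * (q * (q - 1)) + mu p i * q - r p <= 0.

(** At exponent 1 the expression equals [mu p i - r p < 0], so it stays nonpositive slightly beyond
    1. *)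
Lemma barrier_exponent_exists p : admissible p -> exists q, barrier_exponent p q.
Proof.
intros (Hr & Hmu & Hs & _).
assert (H : forall i, exists d, 0 < d /\ forall e, 0 < e <= d ->
   / 2 * Defs.sigma p i ^ 2 * ((1 + e) * (1 + e - 1)) + mu p i * (1 + e) - r p <= 0).
{ intros i; specialize (Hmu i).
  set (s := / 2 * Defs.sigma p i ^ 2).
  assert (Hs' : 0 <= s) by (unfold s; generalize (pow2_ge_0 (Defs.sigma p i)); lra).
  (* For [e <= 1] the left-hand side at [1 + e] is at most [e * m - (r p - mu p i)], whence the
     bound [t] on [e]. *)
  set (m := 2 * s + Rabs (mu p i) + 1).
  assert (Hm : 1 <= m) by (unfold m; generalize (Rabs_pos (mu p i)); lra).
  set (t := (r p - mu p i) / m).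
  assert (Ht : 0 < t) by (apply Rdiv_lt_0_compat; lra).
  exists (Rmin 1 t); split; [apply Rmin_glb_lt; lra|].
  intros e He; generalize (Rmin_l 1 t) (Rmin_r 1 t); intros.
  assert (e * m <= r p - mu p i).
  { replace (r p - mu p i) with (t * m) by (unfold t; field; lra).
    apply Rmult_le_compat_r; lra. }
  assert (mu p i * e <= Rabs (mu p i) * e)
    by (apply Rmult_le_compat_r; [lra|apply Rle_abs]).
  assert (s * (e * e) <= s * e) by (apply Rmult_le_compat_l; [lra|nra]).
  unfold m in H1; nra. }
destruct (H regime0) as [d0 [P0 Q0]], (H regime1) as [d1 [P1 Q1]].
exists (1 + Rmin d0 d1).
generalize (Rmin_l d0 d1) (Rmin_r d0 d1) (Rmin_glb_lt d0 d1 0 P0 P1); intros.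
split; [lra|]; intros []; [apply Q0|apply Q1]; lra.
Qed.

(** The operator is of Euler type, so on a power it acts by the 2 by 2 matrix with diagonal entries
    [G] and off-diagonal entries [lambda]. *)
Lemma L_pow p k (w : regime -> R) beta i x : 0 < x ->
  L p k i (fun j n z => w j * pow_jet beta n z) x
  = (w i * G p k i beta + lambda p i * w (other i)) * Rpower x beta.
Proof. intros Hx; unfold L, G, kill, pow_jet; destruct i, k; field; lra. Qed.

(** With the same power in both regimes the coupling cancels. *)
Lemma L_barrier p q k i x : admissible p -> barrier_exponent p q -> 0 < x ->
  L p k i (fun _ => pow_jet q) x <= 0.
Proof.
intros Hp [Hq Hb] Hx.
assert (Hk := kill_ge0 p k i Hp).
replace (L p k i (fun _ => pow_jet q) x) with
  ((/ 2 * Defs.sigma p i ^ 2 * (q * (q - 1)) + mu p i * q - r p - kill p k i) * Rpower x q)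
  by (unfold L, pow_jet; field; lra).
specialize (Hb i); assert (0 < Rpower x q) by apply exp_pos; nra.
Qed.

(** A small multiple of the barrier pushes the minimum over both regimes into a compact interval,
    where it would be a forbidden negative minimum. At infinity a lower bound along arbitrarily
    large points [u], common to both regimes, suffices. *)
Lemma kinked_minimum_principle p y q (f : region -> regime -> jet) :
  admissible p -> 0 < y -> barrier_exponent p q -> kinked_supersolution p y f ->
  (forall i e, 0 < e -> exists d, 0 < d /\ forall x, 0 < x < d -> - e <= f Lower i 0%nat x) ->
  (forall e M, 0 < e -> exists u, M < u /\ forall i, - (e * Rpower u q) <= f Upper i 0%nat u) ->
  (forall i x, 0 < x <= y -> 0 <= f Lower i 0%nat x) /\
  (forall i x, y <= x -> 0 <= f Upper i 0%nat x).
Proof.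
intros Hp Hy Hq Hf H0 Hinf.
cut (forall i x, 0 < x -> 0 <= glue y (f Lower i 0%nat) (f Upper i 0%nat) x).
{ intros H; destruct Hf as (_ & _ & _ & E & _); split; intros i x Hx.
  - rewrite <- (glue_l y _ (f Upper i 0%nat)) by lra; apply H; lra.
  - rewrite <- (glue_r y (f Lower i 0%nat) (f Upper i 0%nat)) by (trivial; lra); apply H; lra. }
intros i x Hx; apply Rnot_lt_le; intros Hneg.
set (v := glue y (f Lower i 0%nat) (f Upper i 0%nat) x) in *.
assert (HR : 0 < Rpower x q) by apply exp_pos.
(* With this weight the perturbed value at [x] is [v / 2], still negative and below the bound
   [v / 4] that holds near 0. *)
set (s := - v / (2 * Rpower x q)).
assert (Hs : 0 < s) by (apply Rdiv_lt_0_compat; lra).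
set (h := fun k i n z => 1 * f k i n z + s * pow_jet q n z).
assert (Hh : kinked_supersolution p y h).
{ apply kinked_supersolution_add; trivial; [lra|apply is_jet_pow|].
  intros; apply L_barrier; trivial. }
set (g := fun j => glue y (h Lower j 0%nat) (h Upper j 0%nat)).
assert (gE : forall j z, g j z = glue y (f Lower j 0%nat) (f Upper j 0%nat) z + s * Rpower z q).
{ intros j z; unfold g, h, glue; destruct (Rle_dec z y); simpl; ring. }
assert (Hgx : g i x = v / 2).
{ rewrite gE; fold v; unfold s; field; lra. }
destruct (H0 regime0 (- v / 4) ltac:(lra)) as [d0 [Hd0 H00]].
destruct (H0 regime1 (- v / 4) ltac:(lra)) as [d1 [Hd1 H01]].
destruct (Hinf s (Rmax x y) Hs) as [u [Hu Hu']].
generalize (Rmax_l x y) (Rmax_r x y); intros Hux Huy.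
set (d := Rmin (Rmin d0 d1) (Rmin x y)).
assert (Hd : 0 < d /\ d <= d0 /\ d <= d1 /\ d <= x /\ d <= y).
{ unfold d; generalize (Rmin_l (Rmin d0 d1) (Rmin x y)) (Rmin_r (Rmin d0 d1) (Rmin x y))
    (Rmin_l d0 d1) (Rmin_r d0 d1) (Rmin_l x y) (Rmin_r x y); intros.
  repeat split; try lra. repeat apply Rmin_glb_lt; lra. }
assert (Hsmall : forall j z, 0 < z < d -> v / 4 <= g j z).
{ intros j z Hz; rewrite gE, glue_l by lra.
  assert (0 < Rpower z q) by apply exp_pos.
  assert (v / 4 <= f Lower j 0%nat z)
    by (destruct j; [specialize (H00 z ltac:(lra))|specialize (H01 z ltac:(lra))]; lra).
  nra. }
assert (Hh' := Hh); destruct Hh' as (J & _ & _ & E & _).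
assert (Hgu : forall j, 0 <= g j u).
{ intros j; rewrite gE, glue_r by (try apply Hf; lra); specialize (Hu' j); lra. }
destruct (regime_min g (d / 2) u) as [j [z [Hz Hmin]]]; [lra| |].
{ intros j z Hz; apply continuity_pt_filterlim, glue_continuous; trivial;
    apply continuity_pt_filterlim, jet_continuity; trivial; lra. }
assert (Hgz : g j z <= v / 2) by (rewrite <- Hgx; apply Hmin; lra).
assert (z <> u) by (intros ->; specialize (Hgu j); lra).
assert (Hdz : d <= z).
{ apply Rnot_lt_le; intros Hlt; specialize (Hsmall j z ltac:(lra)); lra. }
apply (Rlt_not_le 0 (g j z)); [lra|].
(* The ball of radius [u - z] may reach to the left of the interval; there the bound [v / 4] near 0
   takes over. *)
apply (kinked_no_negative_min p y h j z (u - z)); trivial; try lra.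
intros j' z' Hz' Hz0; change (g j z <= g j' z').
destruct (Rlt_le_dec z' d) as [Hlt|Hle].
- apply Rle_trans with (v / 4); [lra|apply Hsmall; lra].
- apply Hmin; lra.
Qed.

(* If regime 1 touches [0] at the kink, then the minimum conditions there leave
   no room for strict inequality anywhere. *)
Lemma kinked_touching p y (f : region -> regime -> jet) :
  admissible p -> 0 < y -> kinked_supersolution p y f ->
  (forall i x, 0 < x <= y -> 0 <= f Lower i 0%nat x) ->
  (forall i x, y <= x -> 0 <= f Upper i 0%nat x) ->
  f Upper regime1 0%nat y = 0 ->
  L p Upper regime1 (f Upper) y = 0 /\
  f Upper regime0 1%nat y = f Lower regime0 1%nat y.
Proof.
intros Hp Hy (J & L1 & L2 & E & D) HL HU H0.
assert (Hs : forall i, f Upper i 0%nat y = 0 ->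
   f Upper i 1%nat y = 0 /\ f Lower i 1%nat y = 0 /\ 0 <= f Upper i 2%nat y).
{ intros i Hi.
  destruct (jet_right_min (f Upper i) y 1) as [A B]; try lra; trivial.
  { intros z Hz; rewrite Hi; apply HU; lra. }
  assert (C : f Lower i 1%nat y <= 0).
  { apply (jet_left_min (f Lower i) y y); trivial.
    intros z Hz; rewrite E, Hi; apply HL; lra. }
  specialize (D i); destruct (B ltac:(lra)); repeat split; lra. }
destruct (Hs regime1 H0) as (A & B & C).
assert (HLy := L2 regime1 y ltac:(lra)).
unfold L in HLy |- *; rewrite A, H0 in HLy |- *; simpl other in *.
destruct Hp as (_ & _ & _ & Hl & _); specialize (Hl regime1).
assert (H00 := HU regime0 y ltac:(lra)).
assert (0 <= / 2 * Defs.sigma p regime1 ^ 2 * y ^ 2 * f Upper regime1 2%nat y).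
{ apply Rmult_le_pos; trivial.
  generalize (pow2_ge_0 (Defs.sigma p regime1)) (pow2_ge_0 y); nra. }
assert (0 <= lambda p regime1 * (f Upper regime0 0%nat y - 0)) by (apply Rmult_le_pos; lra).
split; [lra|].
(* A sum of nonnegative terms is at most 0, so the coupling term vanishes too: regime 0 also touches
   0 at [y], and both its one-sided slopes vanish. *)
assert (Hz : f Upper regime0 0%nat y = 0).
{ apply (Rmult_eq_reg_l (lambda p regime1)); lra. }
destruct (Hs regime0 Hz) as (A' & B' & _); lra.
Qed.

(** * Signs of the constants *)

Lemma Ktilde_gt0 p : admissible p -> 0 < Ktilde p.
Proof.
intros (_ & _ & _ & _ & _ & Ha & HK & HI & Hne); unfold Ktilde.
assert (0 <= Icost p / alpha p) by (apply Rdiv_le_0_compat; trivial).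
destruct (Rtotal_order 0 (K p)) as [H1|[H1|H1]]; [lra| |lra].
destruct (Rtotal_order 0 (Icost p)) as [H2|[H2|H2]]; [|destruct Hne; congruence|lra].
assert (0 < Icost p / alpha p) by (apply Rdiv_lt_0_compat; trivial); lra.
Qed.

Lemma payoff_eq p x : admissible p -> Ktilde p <= x ->
  payoff p x = alpha p * x - alpha p * Ktilde p.
Proof.
intros (_ & _ & _ & _ & _ & Ha & HK & HI & _) Hx; unfold payoff, Ktilde in *.
assert (0 <= Icost p / alpha p) by (apply Rdiv_le_0_compat; trivial).
rewrite Rmax_left by lra; field; lra.
Qed.

(** With [d_i = r - mu_i], the denominator [constD] exceeds [eta * (d0 + l0)] by
    [d0 * d1 + d0 * l1 + l0 * d1 > 0]. This puts the limit [a_1 / alpha] of condition (f) strictly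
    between 0 and 1. *)
Lemma constD_bound p : admissible p ->
  0 < a p regime1 < alpha p /\ 0 < constD p.
Proof.
intros (Hr & Hmu & _ & Hl & He & Ha & _); unfold a, constD.
generalize (Hmu regime0) (Hmu regime1) (Hl regime0) (Hl regime1); intros.
set (d0 := r p - mu p regime0) in *; set (d1 := r p - mu p regime1) in *.
set (l0 := lambda p regime0) in *; set (l1 := lambda p regime1) in *.
assert (0 < d0 /\ 0 < d1) as [P0 P1] by (unfold d0, d1; lra).
assert (Hn : 0 < eta p * (d0 + l0)) by (apply Rmult_lt_0_compat; lra).
assert (Hlt : eta p * (d0 + l0) < (d0 + l0) * (d1 + l1 + eta p) - l0 * l1).
{ assert (0 < d0 * d1) by (apply Rmult_lt_0_compat; lra).
  assert (0 < d0 * l1) by (apply Rmult_lt_0_compat; lra).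
  assert (0 < l0 * d1) by (apply Rmult_lt_0_compat; lra). nra. }
set (D := (d0 + l0) * (d1 + l1 + eta p) - l0 * l1) in *.
assert (Hq : 0 < eta p * (d0 + l0) / D < 1).
{ split; [apply Rdiv_lt_0_compat; lra|].
  apply (Rmult_lt_reg_r D); [lra|]; unfold Rdiv; rewrite Rmult_assoc, Rinv_l; lra. }
replace (alpha p * eta p * (d0 + l0) / D) with (alpha p * (eta p * (d0 + l0) / D))
  by (field; lra).
split; [nra|lra].
Qed.

Lemma constE_lt0 p : admissible p -> constE p < 0.
Proof.
intros (Hr & _ & _ & Hl & He & _); unfold constE.
generalize (Hl regime0) (Hl regime1); intros; nra.
Qed.

Lemma root_G0_neq0 p k beta : admissible p -> F p k beta = 0 -> G p k regime0 beta <> 0.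
Proof.
intros (_ & _ & _ & Hl & _) H0 HG; unfold F in H0; rewrite HG in H0.
generalize (Hl regime0) (Hl regime1); intros; nra.
Qed.

(** * The candidate with a free threshold *)

(** At a root of [F] the matrix of [L] on [x ^ beta] is singular; this is its kernel vector,
    normalised to 1 in regime 1. *)
Definition weight (p : params) (k : region) (beta : R) (i : regime) : R :=
  match i with
  | regime0 => - lambda p regime0 / G p k regime0 beta
  | regime1 => 1
  end.

Lemma weight_kernel p k beta i : admissible p -> F p k beta = 0 ->
  weight p k beta i * G p k i beta + lambda p i * weight p k beta (other i) = 0.
Proof.
intros Hp H0; assert (HG := root_G0_neq0 p k beta Hp H0); unfold F in H0.
destruct i; simpl weight.
- field; trivial.
- replace (1 * G p k regime1 beta
     + lambda p regime1 * (- lambda p regime0 / G p k regime0 beta))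
    with ((G p k regime0 beta * G p k regime1 beta - lambda p regime0 * lambda p regime1)
          / G p k regime0 beta) by (field; trivial).
  rewrite H0; unfold Rdiv; ring.
Qed.

(** Together with [offset], this gives the affine particular solution for the source [eta * payoff],
    which is absent below the threshold. *)
Definition drift (p : params) (k : region) (i : regime) : R :=
  match k with Lower => 0 | Upper => a p i end.

Definition offset (p : params) (k : region) (i : regime) : R :=
  match k with Lower => 0 | Upper => b p i end.

(* The solution with threshold [y], smooth except for a possible kink of the
   regime 0 component at [y], when the payoff is
   [alpha * (u * x - v * Ktilde)]. *)
Definition candidate (p : params) (bA bB : region -> R) (u v y : R)
    (k : region) (i : regime) : jet := fun n x =>
  1 * (Rpower y (- bA k) * (u * PA p bA bB k * y + v * QA p bA bB k)
         * (weight p k (bA k) i * pow_jet (bA k) n x)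
       + Rpower y (- bB k) * (u * PB p bA bB k * y + v * QB p bA bB k)
         * (weight p k (bB k) i * pow_jet (bB k) n x))
  + 1 * (u * (drift p k i * pow_jet 1 n x) + v * (offset p k i * pow_jet 0 n x)).

Lemma is_jet_scal s f : is_jet f -> is_jet (fun n x => s * f n x).
Proof.
intros Hf x Hx; destruct (Hf x Hx) as [A [B C]]; split; [|split].
- apply is_derive_scal; trivial.
- apply is_derive_scal; trivial.
- apply (continuous_scal_r s (f 2%nat)); trivial.
Qed.

Lemma is_jet_candidate p bA bB u v y k i : is_jet (candidate p bA bB u v y k i).
Proof.
unfold candidate.
repeat first [apply is_jet_pow | apply is_jet_scal
  | apply (is_jet_lin _ _ (fun n x => _) (fun n x => _))].
Qed.

Lemma F_exponents p bA bB k : is_exponents p bA bB -> F p k (bA k) = 0 /\ F p k (bB k) = 0.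
Proof. intros (H1 & H2 & _ & H3 & H4 & _); destruct k; split; trivial. Qed.

Lemma L_candidate p bA bB u v y k i x :
  admissible p -> is_exponents p bA bB -> 0 < x ->
  L p k i (candidate p bA bB u v y k) x
  = - kill p k i * (alpha p * (u * x - v * Ktilde p)).
Proof.
intros Hp Hb Hx.
destruct (F_exponents p bA bB k Hb) as [HA HB].
unfold candidate.
rewrite (L_lin p k i 1 1
  (fun j n z => Rpower y (- bA k) * (u * PA p bA bB k * y + v * QA p bA bB k)
         * (weight p k (bA k) j * pow_jet (bA k) n z)
       + Rpower y (- bB k) * (u * PB p bA bB k * y + v * QB p bA bB k)
         * (weight p k (bB k) j * pow_jet (bB k) n z))
  (fun j n z => u * (drift p k j * pow_jet 1 n z) + v * (offset p k j * pow_jet 0 n z))).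
rewrite (L_lin p k i _ _ (fun j n z => weight p k (bA k) j * pow_jet (bA k) n z)
  (fun j n z => weight p k (bB k) j * pow_jet (bB k) n z)).
rewrite (L_lin p k i u v (fun j n z => drift p k j * pow_jet 1 n z)
  (fun j n z => offset p k j * pow_jet 0 n z)).
rewrite !L_pow, !weight_kernel by trivial.
rewrite Rpower_1, Rpower_O by trivial.
destruct (constD_bound p Hp) as [_ HD]; assert (HE := constE_lt0 p Hp).
destruct k; [destruct i; simpl; ring|].
(* The constants [a] and [b] solve 2 by 2 linear systems, at the exponents 1 and 0, with
   determinants [constD] and [- constE]. *)
assert (HD' : drift p Upper i * G p Upper i 1 + lambda p i * drift p Upper (other i)
   = - kill p Upper i * alpha p).
{ unfold constD in HD; destruct i; unfold drift, a, G, kill, other, constD; field; lra. }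
assert (HE' : offset p Upper i * G p Upper i 0 + lambda p i * offset p Upper (other i)
   = kill p Upper i * alpha p * Ktilde p).
{ unfold constE in HE; destruct i; unfold offset, b, G, kill, other, constE; field; lra. }
rewrite HD', HE'; ring.
Qed.

Definition falling (beta : R) (n : nat) : R :=
  match n with 0%nat => 1 | 1%nat => beta | _ => beta * (beta - 1) end.

(** The prefactors [Rpower y (- beta)] cancel the powers at [y], so all matching conditions there
    become rational identities in [y] and the exponents. *)
Lemma candidate_threshold p bA bB u v y k i n : 0 < y -> (n <= 2)%nat ->
  candidate p bA bB u v y k i n y
  = (weight p k (bA k) i * (u * PA p bA bB k * y + v * QA p bA bB k) * falling (bA k) n
     + weight p k (bB k) i * (u * PB p bA bB k * y + v * QB p bA bB k) * falling (bB k) n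
     + u * drift p k i * y * falling 1 n + v * offset p k i * falling 0 n) / y ^ n.
Proof.
intros Hy Hn.
assert (Hpow : forall beta, pow_jet beta n y = Rpower y beta * falling beta n / y ^ n).
{ intros beta; destruct n as [|[|[|n]]]; unfold pow_jet, falling; try (field; lra).
  apply le_S_n, le_S_n in Hn; inversion Hn. }
unfold candidate; rewrite !Hpow, (Rpower_1 y Hy), (Rpower_O y Hy), !Rpower_Ropp.
assert (forall beta, Rpower y beta <> 0)
  by (intros; apply Rgt_not_eq, exp_pos).
assert (y ^ n <> 0) by (apply pow_nonzero; lra).
field; repeat split; trivial.
Qed.

Lemma exponents_separated p bA bB : is_exponents p bA bB ->
  bA Lower - bB Lower <> 0 /\ bA Upper - bB Upper <> 0 /\
  bA Lower + bB Lower - bA Upper - bB Upper <> 0.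
Proof. intros (_ & _ & H1 & _ & _ & H2); repeat split; lra. Qed.

(** The constants P and Q solve the linear system that prescribes this value on both sides and
    equates the first and second derivatives of regime 1; the check needs only that their
    denominators do not vanish. *)
Lemma candidate_value p bA bB u v y k : admissible p -> is_exponents p bA bB -> 0 < y ->
  candidate p bA bB u v y k regime1 0%nat y = alpha p * (u * y - v * Ktilde p).
Proof.
intros Hp Hb Hy; rewrite candidate_threshold by (trivial; repeat constructor).
destruct (exponents_separated p bA bB Hb) as (H1 & H2 & H3).
destruct k; unfold PA, PB, QA, QB, denom, constS, drift, offset, weight, falling;
  field; auto.
Qed.

Lemma candidate_C2_regime1 p bA bB u v y n : is_exponents p bA bB -> 0 < y -> (n <= 2)%nat ->
  candidate p bA bB u v y Lower regime1 n y = candidate p bA bB u v y Upper regime1 n y.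
Proof.
intros Hb Hy Hn; rewrite !candidate_threshold by trivial.
destruct (exponents_separated p bA bB Hb) as (H1 & H2 & H3).
apply (f_equal (fun z => z / y ^ n)).
destruct n as [|[|n]]; unfold PA, PB, QA, QB, denom, constS, drift, offset, weight, falling;
  field; auto.
Qed.

Lemma candidate_C0 p bA bB u v y i : admissible p -> is_exponents p bA bB -> 0 < y ->
  candidate p bA bB u v y Lower i 0%nat y = candidate p bA bB u v y Upper i 0%nat y.
Proof.
intros Hp Hb Hy.
destruct i; [|apply candidate_C2_regime1; trivial; repeat constructor].
(* The regime 1 equations on both sides of [y] determine the regime 0 values. *)
assert (HL := L_candidate p bA bB u v y Lower regime1 y Hp Hb Hy).
assert (HU := L_candidate p bA bB u v y Upper regime1 y Hp Hb Hy).
assert (HV := candidate_value p bA bB u v y Upper Hp Hb Hy).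
unfold L in HL, HU; simpl other in HL, HU; simpl kill in HL, HU.
rewrite !candidate_C2_regime1 in HL by (trivial; repeat constructor).
destruct Hp as (_ & _ & _ & Hl & _); specialize (Hl regime1).
apply (Rmult_eq_reg_l (lambda p regime1)); [|lra].
rewrite HV in HL, HU; lra.
Qed.

(** Once values and slopes agree, the regime 0 equation on the two sides of [y] forces equal second
    derivatives. *)
Lemma candidate_smooth_fit p bA bB u v y : admissible p -> is_exponents p bA bB -> 0 < y ->
  candidate p bA bB u v y Upper regime0 1%nat y = candidate p bA bB u v y Lower regime0 1%nat y ->
  forall i n, (n <= 2)%nat ->
  candidate p bA bB u v y Lower i n y = candidate p bA bB u v y Upper i n y.
Proof.
intros Hp Hb Hy H1 i n Hn.
destruct i; [|apply candidate_C2_regime1; trivial].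
destruct n as [|[|n]]; [apply candidate_C0; trivial|auto|].
replace (S (S n)) with 2%nat by (do 2 apply le_S_n in Hn; inversion Hn; trivial).
assert (HL := L_candidate p bA bB u v y Lower regime0 y Hp Hb Hy).
assert (HU := L_candidate p bA bB u v y Upper regime0 y Hp Hb Hy).
unfold L in HL, HU; simpl other in HL, HU; simpl kill in HL, HU.
rewrite H1, <- !candidate_C0 in HU by trivial.
destruct Hp as (_ & _ & Hs & _); specialize (Hs regime0).
apply (Rmult_eq_reg_l (/ 2 * Defs.sigma p regime0 ^ 2 * y ^ 2)); [lra|].
apply Rgt_not_eq; repeat apply Rmult_lt_0_compat; try lra; apply pow_lt; lra.
Qed.

(* [xstar] is [- xstar_num / xstar_den]. *)
Definition xstar_num (p : params) (bA bB : region -> R) : R :=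
  (1 - bA Lower) * QA p bA bB Lower / G p Lower regime0 (bA Lower)
  + (1 - bB Lower) * QB p bA bB Lower / G p Lower regime0 (bB Lower)
  + (bA Upper - 1) * QA p bA bB Upper / G p Upper regime0 (bA Upper)
  + (bB Upper - 1) * QB p bA bB Upper / G p Upper regime0 (bB Upper)
  + b p regime0 / lambda p regime0.

Definition xstar_den (p : params) (bA bB : region -> R) : R :=
  (1 - bA Lower) * PA p bA bB Lower / G p Lower regime0 (bA Lower)
  + (1 - bB Lower) * PB p bA bB Lower / G p Lower regime0 (bB Lower)
  + (bA Upper - 1) * PA p bA bB Upper / G p Upper regime0 (bA Upper)
  + (bB Upper - 1) * PB p bA bB Upper / G p Upper regime0 (bB Upper).

Lemma candidate_jump p bA bB u v y : admissible p -> is_exponents p bA bB -> 0 < y ->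
  y * (candidate p bA bB u v y Upper regime0 1%nat y
       - candidate p bA bB u v y Lower regime0 1%nat y)
  = - lambda p regime0 * (u * y * xstar_den p bA bB + v * xstar_num p bA bB).
Proof.
intros Hp Hb Hy.
assert (H0 := candidate_C0 p bA bB u v y regime0 Hp Hb Hy).
set (c := candidate p bA bB u v y) in *.
(* By continuity the jump can be read off [f - y * f']. This expression annihilates linear terms and
   multiplies [y ^ beta] by [1 - beta], which explains the factors in [xstar] and the absence of
   [a p regime0]. *)
replace (y * (c Upper regime0 1%nat y - c Lower regime0 1%nat y))
  with ((c Lower regime0 0%nat y - y * c Lower regime0 1%nat y)
        - (c Upper regime0 0%nat y - y * c Upper regime0 1%nat y)) by (rewrite H0; ring).
unfold c; rewrite !candidate_threshold by (trivial; repeat constructor).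
unfold xstar_num, xstar_den, weight, falling, drift, offset.
destruct (F_exponents p bA bB Lower Hb) as [G1 G2].
destruct (F_exponents p bA bB Upper Hb) as [G3 G4].
apply root_G0_neq0 in G1, G2, G3, G4; trivial.
destruct Hp as (_ & _ & _ & Hl & _); specialize (Hl regime0).
field; repeat split; trivial; lra.
Qed.

(** * Behaviour at 0 and at infinity, and the slope of the jump *)

Lemma Rpower_superlinear q c M : 1 < q ->
  exists u, M < u /\ 0 < u /\ forall x, u <= x -> c * x <= Rpower x q.
Proof.
(* Beyond this point [(q - 1) * ln x >= Rabs c], and [exp t >= 1 + t] concludes. *)
intros Hq; exists (Rmax (M + 1) (exp (Rabs c / (q - 1)))).
generalize (Rmax_l (M + 1) (exp (Rabs c / (q - 1))))
  (Rmax_r (M + 1) (exp (Rabs c / (q - 1)))) (exp_pos (Rabs c / (q - 1))); intros H1 H2 H3.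
split; [lra|split; [lra|]]; intros x Hx.
replace q with (1 + (q - 1)) at 1 by ring.
rewrite Rpower_plus, Rpower_1, Rmult_comm by lra.
apply Rmult_le_compat_l; [lra|].
assert (Hl : Rabs c / (q - 1) <= ln x).
{ rewrite <- (ln_exp (Rabs c / (q - 1))); apply ln_le; lra. }
assert (He := exp_ineq1_le ((q - 1) * ln x)).
assert (Rabs c <= (q - 1) * ln x).
{ replace (Rabs c) with ((q - 1) * (Rabs c / (q - 1))) by (field; lra).
  apply Rmult_le_compat_l; lra. }
unfold Rpower; generalize (Rle_abs c); lra.
Qed.

Lemma linear_growth (g : regime -> R -> R) q C M0 : 1 < q ->
  (forall i x, M0 <= x -> - (C * x) <= g i x) ->
  forall e M, 0 < e -> exists u, M < u /\ forall i, - (e * Rpower u q) <= g i u.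
Proof.
intros Hq Hg e M He.
destruct (Rpower_superlinear q (C / e) (Rmax M M0) Hq) as [u [Hu [_ Hu']]].
generalize (Rmax_l M M0) (Rmax_r M M0); intros.
exists u; split; [lra|]; intros i.
apply Rle_trans with (2 := Hg i u ltac:(lra)), Ropp_le_contravar.
replace (C * u) with (e * (C / e * u)) by (field; lra).
apply Rmult_le_compat_l; [lra|apply Hu'; lra].
Qed.

Definition vanishes_at0 (f : R -> R) : Prop :=
  forall e, 0 < e -> exists d, 0 < d /\ forall x, 0 < x < d -> Rabs (f x) <= e.

Lemma vanishes_at0_lin s t f g : vanishes_at0 f -> vanishes_at0 g ->
  vanishes_at0 (fun x => s * f x + t * g x).
Proof.
intros Hf Hg e He.
assert (Hs := Rabs_pos s); assert (Ht := Rabs_pos t).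
set (e' := e / (Rabs s + Rabs t + 1)).
assert (He' : 0 < e') by (apply Rdiv_lt_0_compat; lra).
destruct (Hf e' He') as [d1 [P1 Q1]], (Hg e' He') as [d2 [P2 Q2]].
exists (Rmin d1 d2); split; [apply Rmin_glb_lt; trivial|]; intros x Hx.
generalize (Rmin_l d1 d2) (Rmin_r d1 d2); intros.
specialize (Q1 x ltac:(lra)); specialize (Q2 x ltac:(lra)).
apply Rle_trans with (1 := Rabs_triang _ _); rewrite !Rabs_mult.
assert (Rabs s * Rabs (f x) <= Rabs s * e') by (apply Rmult_le_compat_l; trivial).
assert (Rabs t * Rabs (g x) <= Rabs t * e') by (apply Rmult_le_compat_l; trivial).
replace e with (e' * (Rabs s + Rabs t + 1)) by (unfold e'; field; lra).
lra.
Qed.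

Lemma vanishes_at0_ext f g : (forall x, 0 < x -> f x = g x) -> vanishes_at0 f -> vanishes_at0 g.
Proof.
intros E Hf e He; destruct (Hf e He) as [d [Hd H]]; exists d; split; trivial.
intros x Hx; rewrite <- E by lra; apply H, Hx.
Qed.

Lemma vanishes_at0_Rpower beta : 0 < beta -> vanishes_at0 (fun x => Rpower x beta).
Proof.
intros Hb e He; exists (Rpower e (/ beta)); split; [apply exp_pos|]; intros x Hx.
rewrite Rabs_pos_eq by (apply Rlt_le, exp_pos).
replace e with (Rpower (Rpower e (/ beta)) beta)
  by (rewrite Rpower_mult, Rinv_l, Rpower_1; lra).
apply Rle_Rpower_l; lra.
Qed.

Lemma vanishes_at0_filterlim f :
  filterlim f (at_right 0) (locally 0) <-> vanishes_at0 f.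
Proof.
split; intros Hf.
- intros e He.
  destruct (Hf (fun z => Rabs z <= e)) as [d Hd].
  { exists (mkposreal e He); intros z Hz.
    apply Rlt_le; rewrite <- (Rminus_0_r z); apply Hz. }
  exists d; split; [apply cond_pos|]; intros x Hx; apply Hd; [|lra].
  apply (Rle_lt_trans _ (Rabs (x - 0))); [apply Rle_refl|].
  rewrite Rminus_0_r, Rabs_pos_eq; lra.
- intros P [e He].
  destruct (Hf (e / 2)) as [d [Hd H]]; [generalize (cond_pos e); lra|].
  exists (mkposreal d Hd); intros x Hx Hx0; apply He.
  assert (Hx' : Rabs (x - 0) < d) by exact Hx.
  rewrite Rminus_0_r, Rabs_pos_eq in Hx' by lra.
  change (Rabs (f x - 0) < e); rewrite Rminus_0_r.
  generalize (H x ltac:(lra)) (cond_pos e); lra.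
Qed.

Lemma candidate_vanishes_at0 p bA bB u v y i : is_exponents p bA bB ->
  vanishes_at0 (candidate p bA bB u v y Lower i 0%nat).
Proof.
intros (_ & _ & H & _).
apply vanishes_at0_ext with (2 := vanishes_at0_lin
  (Rpower y (- bA Lower) * (u * PA p bA bB Lower * y + v * QA p bA bB Lower)
     * weight p Lower (bA Lower) i)
  (Rpower y (- bB Lower) * (u * PB p bA bB Lower * y + v * QB p bA bB Lower)
     * weight p Lower (bB Lower) i) _ _
  (vanishes_at0_Rpower (bA Lower) ltac:(lra)) (vanishes_at0_Rpower (bB Lower) ltac:(lra))).
intros x Hx; unfold candidate, drift, offset, pow_jet; ring.
Qed.

(** The upper exponents are negative, so for [x >= 1] their powers are at most 1 and only the linear
    term can grow. *)
Lemma candidate_asymptotics p bA bB u v y : is_exponents p bA bB ->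
  exists C, 0 <= C /\ forall i x, 1 <= x ->
    Rabs (candidate p bA bB u v y Upper i 0%nat x - u * a p i * x) <= C.
Proof.
intros (_ & _ & _ & _ & _ & H).
set (cA := Rpower y (- bA Upper) * (u * PA p bA bB Upper * y + v * QA p bA bB Upper)).
set (cB := Rpower y (- bB Upper) * (u * PB p bA bB Upper * y + v * QB p bA bB Upper)).
set (C i := Rabs (cA * weight p Upper (bA Upper) i)
  + Rabs (cB * weight p Upper (bB Upper) i) + Rabs (v * b p i)).
assert (HC : forall i, 0 <= C i) by (intros i; unfold C; repeat apply Rplus_le_le_0_compat; apply Rabs_pos).
exists (C regime0 + C regime1); split.
{ generalize (HC regime0) (HC regime1); lra. }
intros i x Hx; apply Rle_trans with (C i);
  [|generalize (HC regime0) (HC regime1); destruct i; lra].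
assert (Hpow : forall c beta, beta <= 0 -> Rabs (c * Rpower x beta) <= Rabs c).
{ intros c beta Hb; rewrite Rabs_mult, (Rabs_pos_eq (Rpower x beta)) by (apply Rlt_le, exp_pos).
  rewrite <- (Rmult_1_r (Rabs c)) at 2; apply Rmult_le_compat_l; [apply Rabs_pos|].
  rewrite <- (Rpower_O x) by lra; apply Rle_Rpower; trivial. }
replace (candidate p bA bB u v y Upper i 0%nat x - u * a p i * x) with
  (cA * weight p Upper (bA Upper) i * Rpower x (bA Upper)
   + cB * weight p Upper (bB Upper) i * Rpower x (bB Upper) + v * b p i).
2:{ unfold candidate, drift, offset, pow_jet; rewrite Rpower_1, Rpower_O by lra.
    unfold cA, cB; ring. }
apply Rle_trans with (1 := Rabs_triang _ _), Rplus_le_compat_r.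
apply Rle_trans with (1 := Rabs_triang _ _), Rplus_le_compat; apply Hpow; lra.
Qed.

Lemma candidate_linear_bound p bA bB u v y : is_exponents p bA bB ->
  exists C, forall i x, 1 <= x ->
    Rabs (candidate p bA bB u v y Upper i 0%nat x) <= C * x.
Proof.
intros Hb; destruct (candidate_asymptotics p bA bB u v y Hb) as [C [HC H]].
set (m i := Rabs (u * a p i)).
assert (Hm : forall i, 0 <= m i) by (intros; apply Rabs_pos).
exists (C + (m regime0 + m regime1)); intros i x Hx.
replace (candidate p bA bB u v y Upper i 0%nat x) with
  (candidate p bA bB u v y Upper i 0%nat x - u * a p i * x + u * a p i * x) by ring.
apply Rle_trans with (1 := Rabs_triang _ _).
rewrite Rmult_plus_distr_r; apply Rplus_le_compat.
- apply Rle_trans with (1 := H i x Hx); nra.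
- rewrite Rabs_mult, (Rabs_pos_eq x) by lra; apply Rmult_le_compat_r; [lra|].
  fold (m i); generalize (Hm regime0) (Hm regime1); destruct i; lra.
Qed.

(* If the value for the payoff [alpha x] had a convex kink, then its difference to
   the strict supersolution [alpha x] could not vanish at the threshold. *)
Lemma xstar_den_gt0 p bA bB : admissible p -> is_exponents p bA bB -> 0 < xstar_den p bA bB.
Proof.
intros Hp Hb; apply Rnot_le_lt; intros Hden.
(* For [u = 1] and [v = 0] the jump in slope is [- lambda p regime0 * xstar_den] at every threshold,
   so the threshold 1 is as good as any. *)
set (c := candidate p bA bB 1 0 1).
set (f := fun k i n x => alpha p * pow_jet 1 n x + (-1) * c k i n x).
(* The killing of [alpha * x] cancels the source of the candidate, leaving the same strictly
   negative expression in both regions. *)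
assert (Hlin : forall k i x, 0 < x -> L p k i (f k) x = alpha p * (mu p i - r p) * x).
{ intros k i x Hx; unfold f.
  rewrite (L_lin p k i (alpha p) (-1) (fun _ => pow_jet 1) (c k)).
  unfold c; rewrite L_candidate by trivial.
  unfold L, pow_jet; rewrite Rpower_1 by trivial; field; lra. }
assert (Hneg : forall k i x, 0 < x -> L p k i (f k) x < 0).
{ intros k i x Hx; rewrite Hlin by trivial.
  destruct Hp as (_ & Hmu & _ & _ & _ & Ha & _); specialize (Hmu i).
  assert (0 < alpha p * (r p - mu p i) * x) by (repeat apply Rmult_lt_0_compat; lra).
  lra. }
assert (Hf : kinked_supersolution p 1 f).
{ split; [|split; [|split; [|split]]].
  - intros k i; apply (is_jet_lin _ _ (pow_jet 1) (c k i));
      [apply is_jet_pow|apply is_jet_candidate].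
  - intros i x Hx; apply Rlt_le, Hneg; lra.
  - intros i x Hx; apply Rlt_le, Hneg; lra.
  - intros i; unfold f, c; rewrite candidate_C0 by (trivial; lra); trivial.
  - intros []; unfold f.
    + assert (Hj := candidate_jump p bA bB 1 0 1 Hp Hb ltac:(lra)); fold c in Hj.
      destruct Hp as (_ & _ & _ & Hl & _); specialize (Hl regime0).
      assert (0 <= lambda p regime0 * - xstar_den p bA bB) by (apply Rmult_le_pos; lra).
      lra.
    + unfold c; rewrite candidate_C2_regime1 by (trivial; try lra; repeat constructor); lra. }
destruct (barrier_exponent_exists p Hp) as [q Hq].
destruct (kinked_minimum_principle p 1 q f Hp ltac:(lra) Hq Hf) as [H1 H2].
- intros i e He.
  assert (Hv : vanishes_at0 (f Lower i 0%nat)).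
  { apply (vanishes_at0_lin (alpha p) (-1) (pow_jet 1 0%nat) (c Lower i 0%nat));
      [apply vanishes_at0_Rpower; lra|apply candidate_vanishes_at0; trivial]. }
  destruct (Hv e He) as [d [Hd H]]; exists d; split; trivial.
  intros x Hx; specialize (H x Hx); apply Rabs_le_between in H; lra.
- destruct (candidate_linear_bound p bA bB 1 0 1 Hb) as [C HC].
  apply (linear_growth (fun i => f Upper i 0%nat) q C 1); [apply Hq|].
  intros i x Hx; specialize (HC i x Hx); apply Rabs_le_between in HC.
  unfold f, c; simpl pow_jet; rewrite Rpower_1 by lra.
  destruct Hp as (_ & _ & _ & _ & _ & Ha & _).
  assert (0 <= alpha p * x) by (apply Rmult_le_pos; lra); lra.
- destruct (kinked_touching p 1 f Hp ltac:(lra) Hf H1 H2) as [H3 _].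
  + unfold f, c; rewrite candidate_value by (trivial; lra).
    simpl pow_jet; rewrite Rpower_1 by lra; ring.
  + generalize (Hneg Upper regime1 1 ltac:(lra)); lra.
Qed.

(** * Nonnegativity of the candidate and position of the threshold *)

(** The source is nonnegative above [y] since the payoff is nonnegative beyond [Ktilde], and the
    sign hypothesis says that the kink is concave. *)
Lemma candidate_supersolution p bA bB y :
  admissible p -> is_exponents p bA bB -> Ktilde p <= y ->
  0 <= y * xstar_den p bA bB + xstar_num p bA bB ->
  kinked_supersolution p y (candidate p bA bB 1 1 y).
Proof.
intros Hp Hb Hy Hj; assert (HK := Ktilde_gt0 p Hp).
split; [|split; [|split; [|split]]].
- intros; apply is_jet_candidate.
- intros i x Hx; rewrite L_candidate by (trivial; lra); destruct i; simpl; lra.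
- intros i x Hx; rewrite L_candidate by (trivial; lra).
  assert (Hk := kill_ge0 p Upper i Hp).
  destruct Hp as (_ & _ & _ & _ & _ & Ha & _).
  assert (0 <= kill p Upper i * (alpha p * (1 * x - 1 * Ktilde p)))
    by (repeat apply Rmult_le_pos; lra).
  lra.
- intros; apply candidate_C0; trivial; lra.
- intros [].
  + assert (H := candidate_jump p bA bB 1 1 y Hp Hb ltac:(lra)).
    destruct Hp as (_ & _ & _ & Hl & _); specialize (Hl regime0).
    assert (0 <= lambda p regime0 * (y * xstar_den p bA bB + xstar_num p bA bB))
      by (apply Rmult_le_pos; lra).
    apply Rminus_le, (Rmult_le_reg_l y); lra.
  + rewrite candidate_C2_regime1 by (trivial; try lra; repeat constructor); lra.
Qed.

Lemma candidate_nonneg p bA bB y :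
  admissible p -> is_exponents p bA bB -> Ktilde p <= y ->
  0 <= y * xstar_den p bA bB + xstar_num p bA bB ->
  (forall i x, 0 < x <= y -> 0 <= candidate p bA bB 1 1 y Lower i 0%nat x) /\
  (forall i x, y <= x -> 0 <= candidate p bA bB 1 1 y Upper i 0%nat x).
Proof.
intros Hp Hb Hy Hj; assert (HK := Ktilde_gt0 p Hp).
destruct (barrier_exponent_exists p Hp) as [q Hq].
apply (kinked_minimum_principle p y q); trivial; [lra|apply candidate_supersolution; trivial| |].
- intros i e He.
  destruct (candidate_vanishes_at0 p bA bB 1 1 y i Hb e He) as [d [Hd H]].
  exists d; split; trivial.
  intros x Hx; specialize (H x Hx); apply Rabs_le_between in H; lra.
- destruct (candidate_linear_bound p bA bB 1 1 y Hb) as [C HC].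
  apply (linear_growth (fun i => candidate p bA bB 1 1 y Upper i 0%nat) q C 1); [apply Hq|].
  intros i x Hx; specialize (HC i x Hx); apply Rabs_le_between in HC; lra.
Qed.

(** The payoff vanishes at [Ktilde], so the candidate with that threshold touches 0 in regime 1. A
    strictly concave kink there is thus impossible, and since the jump expression increases in the
    threshold, its zero is not to the left. *)
Lemma Ktilde_le_xstar p bA bB : admissible p -> is_exponents p bA bB ->
  Ktilde p <= xstar p bA bB /\
  xstar p bA bB * xstar_den p bA bB + xstar_num p bA bB = 0.
Proof.
intros Hp Hb; assert (HK := Ktilde_gt0 p Hp); assert (Hd := xstar_den_gt0 p bA bB Hp Hb).
change (xstar p bA bB) with (- (xstar_num p bA bB / xstar_den p bA bB)).
split; [|field; lra].
assert (H : Ktilde p * xstar_den p bA bB + xstar_num p bA bB <= 0).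
{ apply Rnot_lt_le; intros Hlt.
  destruct (candidate_nonneg p bA bB (Ktilde p) Hp Hb) as [H1 H2]; [lra|lra|].
  destruct (kinked_touching p (Ktilde p) (candidate p bA bB 1 1 (Ktilde p))) as [_ H3];
    trivial; [apply candidate_supersolution; trivial; lra| |].
  - rewrite candidate_value by trivial; ring.
  - assert (Hj := candidate_jump p bA bB 1 1 (Ktilde p) Hp Hb HK).
    destruct Hp as (_ & _ & _ & Hl & _); specialize (Hl regime0).
    assert (0 < lambda p regime0 * (Ktilde p * xstar_den p bA bB + xstar_num p bA bB))
      by (apply Rmult_lt_0_compat; lra).
    rewrite H3 in Hj; lra. }
apply (Rmult_le_reg_r (xstar_den p bA bB)); trivial.
replace (- (xstar_num p bA bB / xstar_den p bA bB) * xstar_den p bA bB)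
  with (- xstar_num p bA bB) by (field; lra).
lra.
Qed.

(** * From [Derive] to jets, and the equations at the threshold *)

Lemma jet_of_C2 f : C2_nonneg f -> is_jet (fun n => Derive_n f n).
Proof.
intros (_ & _ & H) x Hx; destruct (H x Hx) as (A & B & C); split; [|split]; trivial.
- apply Derive_correct, A.
- apply Derive_correct, B.
Qed.

Lemma jet_Derive (f : R -> R) (g : jet) : is_jet g -> (forall x, 0 < x -> f x = g 0%nat x) ->
  forall x, 0 < x ->
    Derive f x = g 1%nat x /\ Derive_n f 2 x = g 2%nat x /\
    ex_derive f x /\ ex_derive (Derive f) x /\ continuous (Derive_n f 2) x.
Proof.
intros Hg E.
assert (D1 : forall x, 0 < x -> is_derive f x (g 1%nat x)).
{ intros x Hx; apply is_derive_ext_loc with (2 := proj1 (Hg x Hx)).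
  generalize (open_gt 0 x Hx); apply filter_imp; intros; symmetry; auto. }
assert (D2 : forall x, 0 < x -> is_derive (Derive f) x (g 2%nat x)).
{ intros x Hx; apply is_derive_ext_loc with (2 := proj1 (proj2 (Hg x Hx))).
  generalize (open_gt 0 x Hx); apply filter_imp; intros.
  symmetry; apply is_derive_unique; auto. }
intros x Hx; repeat split.
- apply is_derive_unique; auto.
- apply (is_derive_unique (Derive f)); auto.
- eexists; eauto.
- eexists; eauto.
- apply continuous_ext_loc with (2 := proj2 (proj2 (Hg x Hx))).
  generalize (open_gt 0 x Hx); apply filter_imp; intros.
  symmetry; apply (is_derive_unique (Derive f)); auto.
Qed.

Lemma L_continuous p k i (f : regime -> jet) x :
  (forall j, is_jet (f j)) -> 0 < x -> continuity_pt (L p k i f) x.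
Proof.
intros Hf Hx; destruct (Hf i x Hx) as (D0 & D1 & C2).
assert (C1 : continuity_pt (f i 1%nat) x).
{ apply continuity_pt_filterlim, (ex_derive_continuous (V := R_NormedModule)).
  eexists; eauto. }
apply continuity_pt_filterlim in C2.
assert (C0 := jet_continuity (f i) x (Hf i) Hx).
assert (C0' := jet_continuity (f (other i)) x (Hf (other i)) Hx).
assert (Cid : continuity_pt (fun z => z) x) by apply continuity_pt_id.
assert (Cc : forall c, continuity_pt (fun _ => c) x)
  by (intros c; apply continuity_pt_const; intros ? ?; trivial).
unfold L.
repeat first [assumption | apply Cc
  | apply (continuity_pt_plus (fun x => _) (fun x => _))
  | apply (continuity_pt_opp (fun x => _))
  | apply (continuity_pt_mult (fun x => _) (fun x => _))].
Qed.

(** The regime 1 equations are given only away from the threshold; by C^2 regularity they extend to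
    it from either side, as the closed ranges in [kinked_supersolution] require. *)
Lemma continuity_zero_right (h : R -> R) y :
  continuity_pt h y -> (forall x, y < x -> h x = 0) -> h y = 0.
Proof.
intros Hc H; apply NNPP; intros Hne.
assert (Hpos : 0 < Rabs (h y)) by (apply Rabs_pos_lt; trivial).
destruct (Hc _ Hpos) as [d [Hd Hlim]].
specialize (Hlim (y + d / 2)); simpl in Hlim; unfold R_dist, D_x, no_cond in Hlim.
rewrite H in Hlim by lra.
rewrite Rminus_0_l, Rabs_Ropp in Hlim.
apply (Rlt_irrefl (Rabs (h y))), Hlim; repeat split; try lra.
rewrite Rabs_pos_eq; lra.
Qed.

Lemma continuity_zero_left (h : R -> R) y : 0 < y ->
  continuity_pt h y -> (forall x, 0 < x < y -> h x = 0) -> h y = 0.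
Proof.
intros Hy Hc H; apply NNPP; intros Hne.
assert (Hpos : 0 < Rabs (h y)) by (apply Rabs_pos_lt; trivial).
destruct (Hc _ Hpos) as [d [Hd Hlim]].
set (e := Rmin d y).
assert (He : 0 < e /\ e <= d /\ e <= y)
  by (unfold e; generalize (Rmin_l d y) (Rmin_r d y) (Rmin_glb_lt d y 0 Hd Hy); lra).
specialize (Hlim (y - e / 2)); simpl in Hlim; unfold R_dist, D_x, no_cond in Hlim.
rewrite H in Hlim by lra.
rewrite Rminus_0_l, Rabs_Ropp in Hlim.
apply (Rlt_irrefl (Rabs (h y))), Hlim; repeat split; try lra.
replace (y - e / 2 - y) with (- (e / 2)) by ring; rewrite Rabs_Ropp, Rabs_pos_eq; lra.
Qed.

(** * Growth of an arbitrary solution *)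

Lemma solution_linear_growth p W y : admissible p -> is_solution p W y ->
  exists M, forall x, M < x -> W regime1 x <= alpha p * x.
Proof.
intros Hp (_ & _ & _ & _ & _ & _ & _ & l & Hl & Hl1).
(* The tolerance [1 - l] brings the ratio below 1 eventually. *)
apply is_lim_spec in Hl; destruct (Hl (mkposreal (1 - l) ltac:(lra))) as [M HM].
exists (Rmax M (Ktilde p)); intros x Hx.
generalize (Rmax_l M (Ktilde p)) (Rmax_r M (Ktilde p)); intros.
specialize (HM x ltac:(lra)); simpl in HM; apply Rabs_def2 in HM.
assert (HK := Ktilde_gt0 p Hp).
rewrite payoff_eq in HM by (trivial; lra).
destruct Hp as (_ & _ & _ & _ & _ & Ha & _).
assert (Hpos : 0 < alpha p * x - alpha p * Ktilde p).
{ rewrite <- Rmult_minus_distr_l; apply Rmult_lt_0_compat; lra. }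
assert (0 < alpha p * Ktilde p) by (apply Rmult_lt_0_compat; lra).
set (pi := alpha p * x - alpha p * Ktilde p) in *.
replace (W regime1 x) with (W regime1 x / pi * pi) by (field; lra).
apply Rle_trans with (1 * pi); [apply Rmult_le_compat_r; lra|unfold pi; lra].
Qed.

Lemma solution_L p W y : admissible p -> is_solution p W y ->
  (forall i x, 0 < x < y -> L p Lower i (fun j n => Derive_n (W j) n) x = 0) /\
  (forall i x, y < x -> L p Upper i (fun j n => Derive_n (W j) n) x
     = - kill p Upper i * (alpha p * (1 * x - 1 * Ktilde p))).
Proof.
intros Hp (_ & HK & _ & H0 & HL & HU & _).
assert (HK0 := Ktilde_gt0 p Hp).
split.
- intros [] x Hx; [specialize (H0 x ltac:(lra))|specialize (HL x Hx)];
    unfold L, generator, kill, other in *; change (Derive_n (W regime0) 0 x) with (W regime0 x);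
    change (Derive_n (W regime1) 0 x) with (W regime1 x);
    change (Derive_n (W regime0) 1 x) with (Derive (W regime0) x);
    change (Derive_n (W regime1) 1 x) with (Derive (W regime1) x); lra.
- intros [] x Hx; [specialize (H0 x ltac:(lra))|specialize (HU x Hx);
    rewrite payoff_eq in HU by (trivial; lra)];
    unfold L, generator, kill, other in *; change (Derive_n (W regime0) 0 x) with (W regime0 x);
    change (Derive_n (W regime1) 0 x) with (W regime1 x);
    change (Derive_n (W regime0) 1 x) with (Derive (W regime0) x);
    change (Derive_n (W regime1) 1 x) with (Derive (W regime1) x); lra.
Qed.

(* Otherwise [W regime0 > e x ^ q] eventually, and as a source term in the
   regime 1 equation this makes [W regime1] exceed [(alpha + 1) x - C]. *)
Lemma solution_regime0_growth p W y q : admissible p -> is_solution p W y ->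
  barrier_exponent p q ->
  forall e M, 0 < e -> exists u, M < u /\ W regime0 u <= e * Rpower u q.
Proof.
intros Hp HW Hq e M He; apply NNPP; intros Hno.
assert (Hbig : forall u, M < u -> e * Rpower u q < W regime0 u).
{ intros u Hu; apply Rnot_le_lt; intros Hle; apply Hno; exists u; auto. }
destruct (solution_linear_growth p W y Hp HW) as [M1 HM1].
destruct (solution_L p W y Hp HW) as [_ HU].
assert (HK := Ktilde_gt0 p Hp); assert (HWy : Ktilde p <= y) by apply HW.
assert (HJ : is_jet (fun n => Derive_n (W regime1) n)) by (apply jet_of_C2, HW).
assert (Hk := kill_ge0 p Upper regime1 Hp).
assert (HB := fun x => L_barrier p q Upper regime1 x Hp Hq).
assert (Hp' := Hp); destruct Hp' as (Hr & Hmu & _ & Hl & _ & Ha & _).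
specialize (Hl regime1).
set (N := alpha p + 1).
(* With regime 0 set to 0, the regime 1 operator sends [x] to [- m * x]; beyond [M2] the source
   coming from [W regime0] outweighs [N * m * x]. *)
set (m := r p + kill p Upper regime1 + lambda p regime1 - mu p regime1).
destruct (Rpower_superlinear q (N * m / (lambda p regime1 * e)) (Rmax (Rmax M M1) y))
  as [M2 [HM2 [HM20 Hsup]]]; [apply Hq|].
generalize (Rmax_l (Rmax M M1) y) (Rmax_r (Rmax M M1) y) (Rmax_l M M1) (Rmax_r M M1); intros.
(* The line [N * x - C] vanishes at [M2], where [0 <= W regime1] gives the left boundary
   condition. *)
set (C := N * M2).
assert (HC : 0 < C) by (apply Rmult_lt_0_compat; unfold N; lra).
assert (Hclaim : forall x, M2 < x -> N * x - C <= W regime1 x).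
{ intros x0 Hx0; apply Rnot_lt_le; intros Hlt.
  set (delta := N * x0 - C - W regime1 x0).
  assert (Hdelta : 0 < delta) by (unfold delta; lra).
  assert (HR : 0 < Rpower x0 q) by apply exp_pos.
  (* This barrier weight uses up half of the gap at [x0], leaving a negative value there, and
     secures the right boundary condition at a large [u]. *)
  set (kappa := delta / (2 * Rpower x0 q)).
  assert (Hkappa : 0 < kappa) by (apply Rdiv_lt_0_compat; lra).
  destruct (Rpower_superlinear q (N / kappa) x0) as [u [Hu [Hu0 Hu']]]; [apply Hq|].
  set (f := fun n x => 1 * (1 * Derive_n (W regime1) n x + kappa * pow_jet q n x)
                       + 1 * (- N * pow_jet 1 n x + C * pow_jet 0 n x)).
  assert (Jf : is_jet f).
  { apply (is_jet_lin 1 1 (fun n x => 1 * Derive_n (W regime1) n x + kappa * pow_jet q n x)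
      (fun n x => - N * pow_jet 1 n x + C * pow_jet 0 n x)).
    - apply (is_jet_lin 1 kappa (fun n => Derive_n (W regime1) n)); trivial; apply is_jet_pow.
    - apply is_jet_lin; apply is_jet_pow. }
  assert (f0 : forall x, 0 < x ->
    f 0%nat x = W regime1 x + kappa * Rpower x q - N * x + C).
  { intros x Hx; unfold f, pow_jet; simpl Derive_n; rewrite Rpower_1, Rpower_O by trivial; ring. }
  assert (HW0 : forall x, 0 < x -> 0 <= W regime1 x).
  { intros x Hx; apply (proj1 HW regime1); lra. }
  assert (Hend : forall x, M2 = x \/ u = x -> 0 <= f 0%nat x).
  { intros x Hx; assert (Hx0' : 0 < x) by lra; rewrite f0 by trivial.
    specialize (HW0 x Hx0'); assert (HRx : 0 < Rpower x q) by apply exp_pos.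
    assert (0 < kappa * Rpower x q) by (apply Rmult_lt_0_compat; trivial).
    destruct Hx as [<-|<-]; [unfold C; lra|].
    assert (N * u <= kappa * Rpower u q); [|lra].
    replace (N * u) with (kappa * (N / kappa * u)) by (field; lra).
    apply Rmult_le_compat_l; [lra|apply Hu'; lra]. }
  assert (Hfx0 : f 0%nat x0 < 0).
  { rewrite f0 by lra.
    replace (kappa * Rpower x0 q) with (delta / 2) by (unfold kappa; field; lra).
    unfold delta in *; lra. }
  destruct (continuity_ab_min (f 0%nat) M2 u) as [z [Hmin Hz]]; [lra| |].
  { intros z Hz; apply jet_continuity; trivial; lra. }
  assert (Hfz : f 0%nat z < 0) by (specialize (Hmin x0 ltac:(lra)); lra).
  assert (M2 <> z) by (intros E; specialize (Hend z (or_introl E)); lra).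
  assert (u <> z) by (intros E; specialize (Hend z (or_intror E)); lra).
  destruct (jet_right_min f z (u - z)) as [_ Hr2]; try lra; trivial.
  { intros z' Hz'; apply Hmin; lra. }
  destruct Hr2 as [Hf1 Hf2].
  { apply (jet_left_min f z (z - M2)); try lra; trivial. intros z' Hz'; apply Hmin; lra. }
  (* Placing 0 in regime 0 turns the coupling into extra discounting; the true [W regime0] reappears
     as a source in [Hsplit]. *)
  assert (HL0 := L_negative_min p Upper regime1
    (fun j n x => match j with regime0 => 0 | regime1 => f n x end) z Hp Hfz
    ltac:(simpl; lra) Hf1 Hf2).
  specialize (HU regime1 z ltac:(lra)); specialize (HB z ltac:(lra)).
  specialize (Hbig z ltac:(lra)); specialize (Hsup z ltac:(lra)).
  assert (Hsrc : N * m * z <= lambda p regime1 * (e * Rpower z q)).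
  { replace (N * m * z) with (lambda p regime1 * e * (N * m / (lambda p regime1 * e) * z))
      by (field; lra).
    replace (lambda p regime1 * (e * Rpower z q)) with (lambda p regime1 * e * Rpower z q) by ring.
    apply Rmult_le_compat_l; [apply Rmult_le_pos; lra|trivial]. }
  assert (Hs2 : lambda p regime1 * (e * Rpower z q) < lambda p regime1 * W regime0 z)
    by (apply Rmult_lt_compat_l; lra).
  assert (Hpay : 0 <= kill p Upper regime1 * (alpha p * (1 * z - 1 * Ktilde p)))
    by (repeat apply Rmult_le_pos; lra).
  assert (HPq : 0 < Rpower z q) by apply exp_pos.
  assert (Hsplit : L p Upper regime1
      (fun j n x => match j with regime0 => 0 | regime1 => f n x end) z
    = (L p Upper regime1 (fun j n => Derive_n (W j) n) z - lambda p regime1 * W regime0 z)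
      + kappa * (L p Upper regime1 (fun _ => pow_jet q) z - lambda p regime1 * Rpower z q)
      + N * m * z
      - C * (r p + kill p Upper regime1 + lambda p regime1)).
  { unfold L, f, m, pow_jet; simpl other; cbv iota; simpl Derive_n.
    rewrite Rpower_1, Rpower_O by lra; field; lra. }
  rewrite Hsplit, HU in HL0.
  assert (0 <= C * (r p + kill p Upper regime1 + lambda p regime1))
    by (apply Rmult_le_pos; lra).
  assert (0 <= kappa * - (L p Upper regime1 (fun _ => pow_jet q) z - lambda p regime1 * Rpower z q)).
  { apply Rmult_le_pos; [lra|].
    assert (0 < lambda p regime1 * Rpower z q) by (apply Rmult_lt_0_compat; trivial); lra. }
  lra. }
(* Comparing [(alpha + 1) * x - C] with the upper bound [alpha * x] forces [x <= C]. *)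
set (x := C + 1 + M2).
specialize (Hclaim x ltac:(unfold x; lra)); specialize (HM1 x ltac:(unfold x; lra)).
unfold N, x in *; lra.
Qed.

(** * Comparison of a solution with the candidate *)

Definition difference (p : params) (bA bB : region -> R) (W : regime -> R -> R) (y s : R)
    (k : region) (i : regime) : jet := fun n x =>
  s * Derive_n (W i) n x + - s * candidate p bA bB 1 1 y k i n x.

(** Thresholds and payoffs coincide, so the sources cancel and [L] vanishes on both sides. The
    solution is C^2, so the kink is [- s] times that of the candidate, and the hypothesis makes it
    concave. *)
Lemma difference_supersolution p bA bB W y s :
  admissible p -> is_exponents p bA bB -> is_solution p W y ->
  s * (y * xstar_den p bA bB + xstar_num p bA bB) <= 0 ->
  kinked_supersolution p y (difference p bA bB W y s).
Proof.
intros Hp Hb HW Hs.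
assert (HK := Ktilde_gt0 p Hp); assert (Hy : Ktilde p <= y) by apply HW.
assert (J : forall k i, is_jet (difference p bA bB W y s k i)).
{ intros k i; apply (is_jet_lin s (- s) (fun n => Derive_n (W i) n)).
  - apply jet_of_C2, HW.
  - apply is_jet_candidate. }
destruct (solution_L p W y Hp HW) as [HL HU].
assert (HLin : forall k i x, L p k i (difference p bA bB W y s k) x
   = s * L p k i (fun j n => Derive_n (W j) n) x
     + - s * L p k i (candidate p bA bB 1 1 y k) x).
{ intros k i x; apply (L_lin p k i s (- s) (fun j n => Derive_n (W j) n)). }
assert (EL : forall i x, 0 < x < y -> L p Lower i (difference p bA bB W y s Lower) x = 0).
{ intros i x Hx; rewrite HLin, HL, L_candidate by (trivial; lra); destruct i; simpl; ring. }
assert (EU : forall i x, y < x -> L p Upper i (difference p bA bB W y s Upper) x = 0).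
{ intros i x Hx; rewrite HLin, HU, L_candidate by (trivial; lra); ring. }
split; [|split; [|split; [|split]]]; trivial.
- intros i x Hx; apply Req_le.
  destruct (Req_dec x y) as [->|Hne]; [|apply EL; lra].
  apply continuity_zero_left; [lra|apply L_continuous; trivial; lra|apply EL].
- intros i x Hx; apply Req_le.
  destruct (Req_dec x y) as [->|Hne]; [|apply EU; lra].
  apply continuity_zero_right; [apply L_continuous; trivial; lra|apply EU].
- intros i; unfold difference; rewrite candidate_C0 by (trivial; lra); trivial.
- intros []; unfold difference.
  + assert (H := candidate_jump p bA bB 1 1 y Hp Hb ltac:(lra)).
    destruct Hp as (_ & _ & _ & Hl & _); specialize (Hl regime0).
    assert (0 <= lambda p regime0 * - (s * (y * xstar_den p bA bB + xstar_num p bA bB)))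
      by (apply Rmult_le_pos; lra).
    apply (Rmult_le_reg_l y); [lra|].
    apply (f_equal (Rmult s)) in H; lra.
  + rewrite candidate_C2_regime1 by (trivial; try lra; repeat constructor); lra.
Qed.

Lemma difference_nonneg p bA bB W y s :
  admissible p -> is_exponents p bA bB -> is_solution p W y ->
  s = 1 \/ s = -1 ->
  s * (y * xstar_den p bA bB + xstar_num p bA bB) <= 0 ->
  (forall i x, 0 < x <= y -> 0 <= difference p bA bB W y s Lower i 0%nat x) /\
  (forall i x, y <= x -> 0 <= difference p bA bB W y s Upper i 0%nat x).
Proof.
intros Hp Hb HW Hs1 Hs.
assert (HK := Ktilde_gt0 p Hp); assert (Hy : Ktilde p <= y) by apply HW.
destruct (barrier_exponent_exists p Hp) as [q Hq].
apply (kinked_minimum_principle p y q); trivial;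
  [lra|apply difference_supersolution; trivial| |].
- intros i e He.
  assert (Hv : vanishes_at0 (difference p bA bB W y s Lower i 0%nat)).
  { apply (vanishes_at0_lin s (- s) (W i)); [|apply candidate_vanishes_at0; trivial].
    apply vanishes_at0_filterlim, HW. }
  destruct (Hv e He) as [d [Hd H]]; exists d; split; trivial.
  intros x Hx; specialize (H x Hx); apply Rabs_le_between in H; lra.
- destruct (candidate_linear_bound p bA bB 1 1 y Hb) as [C HC].
  intros e M He; destruct Hs1 as [-> | ->].
  + apply (linear_growth (fun i => difference p bA bB W y 1 Upper i 0%nat) q C 1);
      [apply Hq| |trivial].
    intros i x Hx; specialize (HC i x Hx); apply Rabs_le_between in HC.
    assert (0 <= W i x) by (apply (proj1 HW i); lra).
    unfold difference; simpl Derive_n; lra.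
  + destruct (solution_linear_growth p W y Hp HW) as [M1 HM1].
    destruct (Rpower_superlinear q (2 * (C + alpha p) / e) (Rmax (Rmax M M1) 1))
      as [u0 [Hu0 [_ Hsup]]]; [apply Hq|].
    generalize (Rmax_l (Rmax M M1) 1) (Rmax_r (Rmax M M1) 1) (Rmax_l M M1) (Rmax_r M M1); intros.
    (* Half of [e] absorbs [W regime0] along a sequence of points; the other half absorbs the linear
       bounds on [W regime1] and the candidate. *)
    destruct (solution_regime0_growth p W y q Hp HW Hq (e / 2) u0 ltac:(lra)) as [u [Hu HWu]].
    exists u; split; [lra|]; intros i.
    specialize (HC i u ltac:(lra)); apply Rabs_le_between in HC.
    specialize (Hsup u ltac:(lra)); specialize (HM1 u ltac:(lra)).
    assert (He' : (C + alpha p) * u <= e / 2 * Rpower u q).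
    { replace ((C + alpha p) * u) with (e / 2 * (2 * (C + alpha p) / e * u)) by (field; lra).
      apply Rmult_le_compat_l; lra. }
    assert (0 < e * Rpower u q) by (apply Rmult_lt_0_compat; [trivial|apply exp_pos]).
    destruct Hp as (_ & _ & _ & _ & _ & Ha & _).
    assert (0 < alpha p * u) by (apply Rmult_lt_0_compat; lra).
    unfold difference; simpl Derive_n; destruct i; lra.
Qed.

Lemma solution_threshold p bA bB W y :
  admissible p -> is_exponents p bA bB -> is_solution p W y -> y = xstar p bA bB.
Proof.
intros Hp Hb HW.
assert (HK := Ktilde_gt0 p Hp); assert (Hy : Ktilde p <= y) by apply HW.
set (T := y * xstar_den p bA bB + xstar_num p bA bB).
assert (Htouch : forall s, s = 1 \/ s = -1 -> s * T <= 0 -> T = 0).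
{ intros s Hs1 Hs.
  destruct (difference_nonneg p bA bB W y s Hp Hb HW Hs1 Hs) as [H1 H2].
  destruct (kinked_touching p y (difference p bA bB W y s)) as [_ H3]; trivial; [lra| | |].
  - apply difference_supersolution; trivial.
  - unfold difference; simpl Derive_n; rewrite candidate_value by (trivial; lra).
    assert (HV : W regime1 y = payoff p y) by apply HW.
    rewrite HV, payoff_eq by trivial; ring.
  - assert (H := candidate_jump p bA bB 1 1 y Hp Hb ltac:(lra)).
    replace (candidate p bA bB 1 1 y Upper regime0 1%nat y) with
      (candidate p bA bB 1 1 y Lower regime0 1%nat y) in H
      by (unfold difference in H3; destruct Hs1; subst s; lra).
    destruct Hp as (_ & _ & _ & Hl & _); specialize (Hl regime0).
    apply (Rmult_eq_reg_l (lambda p regime0)); unfold T; lra. }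
assert (HT : T = 0).
(* Whatever the sign of [T], one of the two signs [s] makes the kink concave. *)
{ destruct (Rle_dec T 0); [apply (Htouch 1)|apply (Htouch (-1))]; auto; lra. }
destruct (Ktilde_le_xstar p bA bB Hp Hb) as [_ Hx].
assert (Hd := xstar_den_gt0 p bA bB Hp Hb).
apply (Rmult_eq_reg_r (xstar_den p bA bB)); unfold T in HT; lra.
Qed.

(** * The explicit solution: uniqueness and existence *)

(** The value at 0 is set by hand, since [Rpower] equals 1, not 0, at base 0. *)
Definition value (p : params) (bA bB : region -> R) (i : regime) (x : R) : R :=
  let xs := xstar p bA bB in
  if Rle_dec x 0 then 0
  else glue xs (candidate p bA bB 1 1 xs Lower i 0%nat) (candidate p bA bB 1 1 xs Upper i 0%nat) x.

Lemma solution_unique p bA bB W y :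
  admissible p -> is_exponents p bA bB -> is_solution p W y ->
  forall i x, 0 <= x -> W i x = value p bA bB i x.
Proof.
intros Hp Hb HW i x Hx.
assert (Hy := solution_threshold p bA bB W y Hp Hb HW); subst y.
destruct (Ktilde_le_xstar p bA bB Hp Hb) as [_ HT].
unfold value; destruct (Rle_dec x 0) as [H0|H0].
- replace x with 0 by lra.
  assert (Hc := proj1 (proj2 (proj1 HW i)) 0 (Rle_refl 0)).
  assert (Hl : filterlim (W i) (at_right 0) (locally 0)) by apply HW.
  apply (filterlim_locally_unique (F := at_right 0) (W i)); trivial.
  apply filterlim_filter_le_1 with (2 := Hc).
  intros P [e HP]; exists e; intros z Hz Hz0; apply HP; trivial; lra.
(* At [xstar] the jump vanishes, so both signs are allowed and give the two opposite
   inequalities. *)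
- destruct (difference_nonneg p bA bB W _ 1 Hp Hb HW) as [L1 U1]; [auto|rewrite HT; lra|].
  destruct (difference_nonneg p bA bB W _ (-1) Hp Hb HW) as [L2 U2]; [auto|rewrite HT; lra|].
  unfold difference in *; simpl Derive_n in *.
  unfold glue; destruct (Rle_dec x (xstar p bA bB)).
  + specialize (L1 i x ltac:(lra)); specialize (L2 i x ltac:(lra)); lra.
  + specialize (U1 i x ltac:(lra)); specialize (U2 i x ltac:(lra)); lra.
Qed.

Lemma value_payoff_limit p bA bB : admissible p -> is_exponents p bA bB ->
  is_lim (fun x => value p bA bB regime1 x / payoff p x) p_infty (a p regime1 / alpha p).
Proof.
intros Hp Hb.
assert (HK := Ktilde_gt0 p Hp).
destruct (Ktilde_le_xstar p bA bB Hp Hb) as [Hx _].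
set (xs := xstar p bA bB) in *.
destruct (candidate_asymptotics p bA bB 1 1 xs Hb) as [C [HC HCx]].
destruct (constD_bound p Hp) as [[Ha1 _] _].
assert (Ha : 0 < alpha p) by apply Hp.
apply is_lim_spec; intros e.
(* [B] bounds the numerator left after subtracting the limit, while the denominator
   [alpha p * (x - Ktilde p)] tends to infinity. *)
set (B := C + a p regime1 * Ktilde p).
assert (HB : 0 <= B).
{ unfold B; apply Rplus_le_le_0_compat; [trivial|apply Rmult_le_pos; lra]. }
assert (He := cond_pos e).
assert (HBe : 0 <= B / (alpha p * e)).
{ apply Rdiv_le_0_compat; [trivial|apply Rmult_lt_0_compat; trivial]. }
exists (1 + xs + B / (alpha p * e)); intros x Hlt.
assert (Hv : value p bA bB regime1 x = candidate p bA bB 1 1 xs Upper regime1 0%nat x).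
{ unfold value; fold xs; destruct (Rle_dec x 0); [lra|].
  apply glue_r; [apply candidate_C0; trivial|]; lra. }
rewrite Hv, payoff_eq by (trivial; lra).
assert (H1 := HCx regime1 x ltac:(lra)); apply Rabs_le_between in H1.
set (c := candidate p bA bB 1 1 xs Upper regime1 0%nat x) in *.
set (d := x - Ktilde p).
assert (Hd : B / (alpha p * e) < d) by (unfold d; lra).
assert (Hd0 : 0 < d) by lra.
replace (c / (alpha p * x - alpha p * Ktilde p) - a p regime1 / alpha p)
  with ((c - a p regime1 * x + a p regime1 * Ktilde p) / (alpha p * d))
  by (unfold d in *; field; split; [|split]; nra).
assert (HBd : B < e * (alpha p * d)).
{ replace B with (B / (alpha p * e) * (alpha p * e)) by (field; lra).
  replace (e * (alpha p * d)) with (d * (alpha p * e)) by ring.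
  apply Rmult_lt_compat_r; [apply Rmult_lt_0_compat|]; trivial. }
assert (Had : 0 < alpha p * d) by (apply Rmult_lt_0_compat; trivial).
unfold Rdiv; rewrite Rabs_mult, (Rabs_pos_eq (/ _)) by (apply Rlt_le, Rinv_0_lt_compat; trivial).
apply (Rmult_lt_reg_r (alpha p * d)); trivial.
rewrite Rmult_assoc, Rinv_l, Rmult_1_r by lra.
apply Rle_lt_trans with (2 := HBd); unfold B.
assert (0 <= a p regime1 * Ktilde p) by (apply Rmult_le_pos; lra).
apply Rabs_le; lra.
Qed.

Lemma value_solution p bA bB : admissible p -> is_exponents p bA bB ->
  is_solution p (value p bA bB) (xstar p bA bB).
Proof.
intros Hp Hb.
assert (HK := Ktilde_gt0 p Hp).
destruct (Ktilde_le_xstar p bA bB Hp Hb) as [Hx HT].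
set (xs := xstar p bA bB) in *.
set (c := candidate p bA bB 1 1 xs).
set (g := fun i n => glue xs (c Lower i n) (c Upper i n)).
assert (Hfit : forall i n, (n <= 2)%nat -> c Lower i n xs = c Upper i n xs).
{ apply candidate_smooth_fit; trivial; [lra|].
  assert (Hj := candidate_jump p bA bB 1 1 xs Hp Hb ltac:(lra)).
  rewrite !Rmult_1_l, HT, Rmult_0_r in Hj.
  apply Rmult_integral in Hj; lra. }
assert (Jg : forall i, is_jet (g i)).
{ intros i; apply is_jet_glue; try (apply Hfit; repeat constructor); apply is_jet_candidate. }
assert (Vg : forall i x, 0 < x -> value p bA bB i x = g i 0%nat x).
{ intros i x H; unfold value; destruct (Rle_dec x 0); [lra|trivial]. }
assert (V0 : forall i x, x <= 0 -> value p bA bB i x = 0).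
{ intros i x H; unfold value; destruct (Rle_dec x 0); [trivial|lra]. }
destruct (candidate_nonneg p bA bB xs Hp Hb Hx ltac:(lra)) as [NL NU].
assert (Hlim : forall i, filterlim (value p bA bB i) (at_right 0) (locally 0)).
{ intros i; apply vanishes_at0_filterlim; intros e He.
  destruct (candidate_vanishes_at0 p bA bB 1 1 xs i Hb e He) as [d [Hd H]].
  exists (Rmin d xs); split; [apply Rmin_glb_lt; lra|]; intros x Hx0.
  generalize (Rmin_l d xs) (Rmin_r d xs); intros.
  rewrite Vg by lra; unfold g; rewrite glue_l by lra; apply H; lra. }
(* One identity yields all the equations: [k] is chosen by the side of [xs] on which [x] lies, and
   [kill] is nonzero only in regime 1 above [xs]. *)
assert (HLg : forall k x, 0 < x ->
  (forall j n, g j n x = c k j n x) -> forall i,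
    - r p * value p bA bB i x + generator p i (value p bA bB i) x
    + lambda p i * (value p bA bB (other i) x - value p bA bB i x)
    = kill p k i * (value p bA bB i x - (alpha p * x - alpha p * Ktilde p))).
{ intros k x H Hk i.
  destruct (jet_Derive (value p bA bB i) (g i) (Jg i) (Vg i) x H) as (D1 & D2 & _).
  assert (HL := L_candidate p bA bB 1 1 xs k i x Hp Hb H); fold c in HL.
  unfold L in HL; unfold generator; rewrite D1, D2, !Vg, !Hk by trivial; lra. }
split; [|split; [trivial|split; [trivial|split; [|split; [|split; [|split]]]]]].
- intros i; split; [|split].
  + intros x Hx0; destruct (Rle_dec x 0); [rewrite V0 by trivial; lra|].
    rewrite Vg by lra; unfold g, glue; destruct (Rle_dec x xs); [apply NL|apply NU]; lra.
  + intros x Hx0; destruct (Req_dec x 0) as [->|Hne].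
    * rewrite V0 by lra; intros P HP.
      destruct (Hlim i P HP) as [d Hd]; exists d; intros z Hz Hz0.
      destruct (Req_dec z 0) as [->|Hz1]; [rewrite V0 by lra; apply locally_singleton, HP|].
      apply Hd; [trivial|lra].
    * eapply (filterlim_filter_le_1 (F := locally x)).
      { intros P HP; apply filter_imp with (2 := HP); auto. }
      apply (ex_derive_continuous (V := R_NormedModule)).
      apply (jet_Derive (value p bA bB i) (g i) (Jg i) (Vg i)); lra.
  + intros x Hx0; apply (jet_Derive (value p bA bB i) (g i) (Jg i) (Vg i) x Hx0).
- intros x Hx0.
  destruct (Rle_dec x xs) as [Hxs|Hxs].
  + assert (H := HLg Lower x Hx0 ltac:(intros; apply glue_l; trivial) regime0).
    cbn [other kill] in H; lra.
  + assert (E : forall j n, g j n x = c Upper j n x).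
    { intros j n; unfold g, glue; destruct (Rle_dec x xs); [lra|trivial]. }
    assert (H := HLg Upper x Hx0 E regime0); cbn [other kill] in H; lra.
- intros x Hx0.
  assert (H := HLg Lower x ltac:(lra) ltac:(intros; apply glue_l; lra) regime1).
  cbn [other kill] in H; lra.
- intros x Hx0.
  assert (E : forall j n, g j n x = c Upper j n x).
  { intros j n; unfold g, glue; destruct (Rle_dec x xs); [lra|trivial]. }
  assert (H := HLg Upper x ltac:(lra) E regime1).
  rewrite payoff_eq by (trivial; lra); cbn [other kill] in H; lra.
- rewrite Vg by lra; unfold g; rewrite glue_l by lra.
  unfold c; rewrite candidate_value, payoff_eq by (trivial; lra); ring.
- exists (a p regime1 / alpha p); split; [apply value_payoff_limit; trivial|].
  destruct (constD_bound p Hp) as [[H1 H2] _].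
  assert (Ha : 0 < alpha p) by lra.
  split; [apply Rdiv_lt_0_compat; lra|].
  apply (Rmult_lt_reg_r (alpha p)); trivial.
  unfold Rdiv; rewrite Rmult_assoc, Rinv_l; lra.
Qed.

Theorem proposition3p3 (p : params) (bA bB : region -> R)
  (hp : admissible p) (hb : is_exponents p bA bB) :
  exists (V : regime -> R -> R) (xs : R),
    is_solution p V xs /\
    xs = xstar p bA bB /\
    (forall (i : regime) (x : R), 0 < x < xs ->
       V i x = coefA p bA bB Lower i xs * Rpower x (bA Lower)
               + coefB p bA bB Lower i xs * Rpower x (bB Lower)) /\
    (forall (i : regime) (x : R), xs < x ->
       V i x = coefA p bA bB Upper i xs * Rpower x (bA Upper)
               + coefB p bA bB Upper i xs * Rpower x (bB Upper)
               + a p i * x + b p i) /\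
    (forall (W : regime -> R -> R) (ys : R), is_solution p W ys ->
       ys = xs /\ forall (i : regime) (x : R), 0 <= x -> W i x = V i x).
Proof.
assert (HK := Ktilde_gt0 p hp).
destruct (Ktilde_le_xstar p bA bB hp hb) as [Hx _].
exists (value p bA bB), (xstar p bA bB).
split; [apply value_solution; trivial|split; [trivial|split; [|split]]].
- intros i x Hx0; unfold value; destruct (Rle_dec x 0); [lra|].
  rewrite glue_l by lra.
  unfold candidate, coefA, coefB, weight, drift, offset, pow_jet; destruct i; ring.
- intros i x Hx0; unfold value, glue.
  destruct (Rle_dec x 0); [lra|]; destruct (Rle_dec x (xstar p bA bB)); [lra|].
  unfold candidate, coefA, coefB, weight, drift, offset, pow_jet.
  rewrite Rpower_1, Rpower_O by lra; destruct i; ring.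
- intros W ys HW; split.
  + apply (solution_threshold p bA bB W); trivial.
  + apply (solution_unique p bA bB W ys); trivial.
Qed.
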